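(* Let $A$ be a primitive $N\times N$-matrix with entries in $\{0,1\}$, and let $\mathsf G_A$ be the group of all unitaries $u\in U(N)$ such that $\varphi_u(S_\alpha):=\sum_{\alpha'=1}^Nu_{\alpha',\alpha}S_{\alpha'}$, $\alpha\in\{1,\dots,N\}$, extends to an automorphism $\varphi_u$ of the Cuntz--Krieger algebra $O_A$. For all $u\in\mathsf G_A$ the Voiculescu noncommutative topological entropy vanishes on the automorphism $\varphi_u:O_A\to O_A$, i.e. $\mathrm{ht}(\varphi_u)=0$.
   Context: $N\ge2$; $A$ is primitive if some power of $A$ has all entries positive. $O_A$ is the universal $C^*$-algebra generated by $S_1,\dots,S_N$ subject to $\sum_{i=1}^NS_iS_i^*=1$ and $S_i^*S_k=\delta_{ik}\sum_{j=1}^NA_{ij}S_jS_j^*$; it is unital and nuclear. For a unital nuclear $C^*$-algebra $B$, a finite subset $\Omega\subset B$ and $\varepsilon>0$, $\mathrm{rcp}(\Omega,\varepsilon)$ is the minimum of $\mathrm{rank}(C)$ over all triples $(\phi,\psi,C)$ with $C$ a finite-dimensional $C^*$-algebra and $\phi:B\to C$, $\psi:C\to B$ unital completely positive maps with $\|\psi(\phi(b))-b\|<\varepsilon$ for all $b\in\Omega$; $\mathrm{rank}(C)$ is the dimension of a maximal abelian subalgebra of $C$. For a unital completely positive map $\alpha:B\to B$ put $\Omega^{(n)}=\bigcup_{k=0}^n\alpha^k(\Omega)$ and $$\mathrm{ht}(\alpha)=\sup_{\varepsilon>0,\,\Omega}\ \limsup_{n\to\infty}\frac{\log\mathrm{rcp}(\Omega^{(n)},\varepsilon)}{n},$$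 the supremum being over all $\varepsilon>0$ and all finite subsets $\Omega\subset B$. *)

(* Defs.v *)
From HB Require Import structures.
From mathcomp Require Import all_boot all_order all_algebra.
From mathcomp Require Import all_classical all_reals all_analysis.
From mathcomp Require Export complex spectral.
Set Implicit Arguments.
Unset Strict Implicit.
Unset Printing Implicit Defensive.
Import Order.TTheory GRing.Theory Num.Theory.
Import ComplexField.Normc numFieldNormedType.Exports.
Local Open Scope classical_set_scope.
Local Open Scope complex_scope.
Local Open Scope ring_scope.

(* Unital C*-algebras over R[i], with 1 != 0.  The norm is a field of its own:
   Hierarchy-Builder rejects a join of CompleteNormedModule with Algebra,
   since NumDomain already is the join of their reducts PzSemiRing and
   SemiNormedZmodule. *)
HB.mixin Record isCStar (R : realType) B of GRing.Algebra R[i] B := {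
  cnorm : B -> R;
  star : B -> B;
  cnorm0_eq0 : forall x, cnorm x = 0 -> x = 0;
  ler_cnormD : forall x y, cnorm (x + y) <= cnorm x + cnorm y;
  cnormZ : forall (a : R[i]) x, cnorm (a *: x) = normc a * cnorm x;
  cnorm_complete : forall v : nat -> B,
    (forall eps : R, 0 < eps -> exists n0 : nat, forall m n : nat,
       (n0 <= m)%N -> (n0 <= n)%N -> cnorm (v m - v n) < eps) ->
    exists l, (fun n => cnorm (v n - l)) @ \oo --> (0 : R);
  ler_cnormM : forall x y, cnorm (x * y) <= cnorm x * cnorm y;
  starK : involutive star;
  starD : {morph star : x y / x + y};
  starZ : forall (a : R[i]) x, star (a *: x) = a^* *: star x;
  starM : forall x y, star (x * y) = star y * star x;
  cnorm_star : forall x, cnorm (star x * x) = cnorm x ^+ 2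
}.

#[short(type="cstarType")]
HB.structure Definition CStar (R : realType) :=
  {B of isCStar R B & GRing.Algebra R[i] B}.

#[short(type="fdCstarType")]
HB.structure Definition FinDimCStar (R : realType) :=
  {B of CStar R B & Vector R[i] B}.

Section CStarTheory.
Context (R : realType).
Implicit Types (B D : cstarType R) (C : fdCstarType R).

Definition star_preserving B D (f : B -> D) : Prop :=
  forall x, f (star x) = star (f x).

Definition star_automorphism B (f : {lrmorphism B -> B}) : Prop :=
  star_preserving f /\ bijective f.

Definition star_mx B m n (X : 'M[B]_(m, n)) : 'M[B]_(n, m) :=
  map_mx star X^T.

(* Positivity in the C*-algebra M_n(B). *)
Definition positive_mx B n (X : 'M[B]_n) : Prop :=
  exists Y : 'M[B]_n, X = star_mx Y *m Y.

Definition completely_positive B D (f : {linear B -> D}) : Prop :=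
  forall n (X : 'M[B]_n), positive_mx X -> positive_mx (map_mx f X).

Definition ucp B D (f : {linear B -> D}) : Prop :=
  completely_positive f /\ f 1 = 1.

(* Abelian C*-subalgebras are self-adjoint; closedness is automatic in finite
   dimension. *)
Definition abelian_subalgebra C (V : {vspace C}) : Prop :=
  [/\ forall x y, x \in V -> y \in V -> x * y \in V,
      forall x, x \in V -> star x \in V
    & forall x y, x \in V -> y \in V -> x * y = y * x].

Definition maximal_abelian C (V : {vspace C}) : Prop :=
  abelian_subalgebra V /\
  forall W : {vspace C}, abelian_subalgebra W -> (V <= W)%VS -> W = V.

(* All maximal abelian C*-subalgebras of C have the same dimension. *)
Definition cstar_rank C (r : nat) : Prop :=
  exists2 V : {vspace C}, maximal_abelian V & \dim V = r.

(* The ranks over whose minimum rcp is taken. *)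
Definition rcp_ranks B (Omega : set B) (eps : R) : set nat :=
  [set r | exists (C : fdCstarType R) (phi : {linear B -> C})
             (psi : {linear C -> B}),
     [/\ ucp phi, ucp psi,
         forall b, Omega b -> cnorm (psi (phi b) - b) < eps
       & cstar_rank C r]].

(* When B is not nuclear there may be no rank to minimize over, and then the
   value is +oo. *)
Definition rcp B (Omega : set B) (eps : R) : \bar R :=
  ereal_inf [set (r%:R)%:E | r in rcp_ranks Omega eps].

Definition iter_union B (alpha : B -> B) (Omega : set B) (n : nat) : set B :=
  \bigcup_(k in [set k | (k <= n)%N]) (iter k alpha @` Omega).

Definition ht_at B (alpha : B -> B) (Omega : set B) (eps : R) : \bar R :=
  limn_esup (fun n => lne (rcp (iter_union alpha Omega n) eps)
                      * (n%:R^-1)%:E)%E.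

Definition ht B (alpha : B -> B) : \bar R :=
  ereal_sup [set h | exists (Omega : set B) (eps : R),
    [/\ finite_set Omega, 0 < eps & h = ht_at alpha Omega eps]].

Definition zero_one N (A : 'M[nat]_N) : Prop :=
  forall i j, A i j = 0%N \/ A i j = 1%N.

Definition primitive_mx N (A : 'M[nat]_N) : Prop :=
  exists2 k, (0 < k)%N & forall i j, (0 < (A ^+ k)%R i j)%N.

Definition ck_relations N (A : 'M[nat]_N) B (S : 'I_N -> B) : Prop :=
  \sum_i S i * star (S i) = 1 /\
  forall i k, star (S i) * S k =
    (\sum_j (S j * star (S j)) *+ A i j) *+ (i == k).

Definition cstar_subalgebra B (E : set B) : Prop :=
  [/\ forall (v : nat -> B) l, (forall n, E (v n)) ->
        (fun n => cnorm (v n - l)) @ \oo --> (0 : R) -> E l,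
      forall a x y, E x -> E y -> E (a *: x + y),
      forall x y, E x -> E y -> E (x * y), forall x, E x -> E (star x)
    & E 1].

Definition cstar_generated N B (S : 'I_N -> B) : Prop :=
  forall E : set B, cstar_subalgebra E -> (forall i, E (S i)) -> E = setT.

(* (B, S) is the universal C*-algebra O_A together with its canonical
   generators; this determines it up to a unique isomorphism. *)
Definition is_cuntz_krieger N (A : 'M[nat]_N) B (S : 'I_N -> B) : Prop :=
  [/\ ck_relations A S, cstar_generated S
    & forall D (T : 'I_N -> D), ck_relations A T ->
        exists2 f : {lrmorphism B -> D},
          star_preserving f & forall i, f (S i) = T i].

(* f is an automorphism of B extending S_a |-> \sum_b u_(b, a) S_b. *)
Definition is_varphi N B (S : 'I_N -> B) (u : 'M[R[i]]_N)
    (f : {lrmorphism B -> B}) : Prop :=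
  star_automorphism f /\ forall a, f (S a) = \sum_b u b a *: S b.

Definition G_A N B (S : 'I_N -> B) : set 'M[R[i]]_N :=
  [set u | u \is unitarymx /\ exists f, is_varphi S u f].

End CStarTheory.

(* Main.v *)
(* Let V_pq be the span of the words S_mu (S_nu)^* with |mu| = p, |nu| = q.  The
   automorphism phi_u maps each V_pq into itself, and the union of the V_pq spans
   a dense subspace.  So it is enough to approximate the identity of O_A by maps
   theta = psi o phi which factor through matrices and multiply each V_pq by a
   scalar close to 1: such a theta is uniformly close to the identity along whole
   orbits, and the ranks rcp(Omega^(n), eps) stay bounded in n.

   To get theta, let w range over the admissible words with n < |w| <= 2n.  By
   primitivity there are isometries U_j, homogeneous of one degree, for which
   Z_w = S_w U_(last letter of w) is an isometry; with a state omega vanishing on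
   elements of small nonzero gauge degree put
     phi(x) = (omega(Z_w^* x Z_v))_(w, v),
     psi(X) = n^-1 sum_(w, v) X_wv S_w S_v^*.
   On V_pq the composite is a Fejer-type multiplier, with value between
   1 - (p + q) / n and 1.

   States exist by the Hahn-Banach theorem, once x^* x is known to be positive in
   the sense that ||t - x^* x|| <= t for some t. *)
Require Import Defs.
From HB Require Import structures.
From mathcomp Require Import all_boot all_order all_algebra.
From mathcomp Require Import all_classical all_reals all_analysis.
From mathcomp Require Import zify ring lra.
Import Order.TTheory GRing.Theory Num.Theory.
Import numFieldNormedType.Exports.
Import ComplexField.Normc.
Set Implicit Arguments.
Unset Strict Implicit.
Unset Printing Implicit Defensive.
Local Open Scope classical_set_scope.
Local Open Scope sesquilinear_scope.
Local Open Scope complex_scope.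
Local Open Scope ring_scope.

(** The element [star S_w * S_w] is the source projection of the last letter of w, not 1, so a map
    phi built from the S_w alone would not be unital; the U_j live under these projections and
    repair this. As all U_j have the same degree, [star Z_w * Z_v] has degree |v| - |w|, and omega
    kills it when the lengths differ; omega is needed because Z_w and Z_v need not be orthogonal in
    the algebra when one word is a prefix of the other. Lengths above n ensure that the adjoint of
    S_u with |u| <= n strips a prefix and leaves a nonempty word with the same last letter. For each
    length the S_w S_w^* sum to 1, and n lengths occur, whence the factor n^-1. Two words pair
    nontrivially with S_u S_v^* only if they share the tail after u and v, so the multiplier counts
    the lengths a, b with a - p = b - q. Passing from monomials to all of O_A takes a norm bound
    valid for all unital positive maps. The constant 2 is enough and follows from the order
    structure alone, so the C*-theory rests on square roots found by a contraction, without
    functional calculus. *)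

(** * Identities in abelian groups by reflection *)

Inductive zmod_expr : Type :=
| ZZero | ZAtom of nat | ZAdd of zmod_expr & zmod_expr | ZOpp of zmod_expr.

Fixpoint zmod_eval (V : zmodType) (env : seq V) t : V :=
  match t with
  | ZZero => 0
  | ZAtom i => nth 0 env i
  | ZAdd t1 t2 => zmod_eval env t1 + zmod_eval env t2
  | ZOpp t => - zmod_eval env t
  end.

Fixpoint zmod_coef t i : int :=
  match t with
  | ZZero => 0
  | ZAtom j => if j == i then 1 else 0
  | ZAdd t1 t2 => zmod_coef t1 i + zmod_coef t2 i
  | ZOpp t => - zmod_coef t i
  end.

Lemma zmod_evalE (V : zmodType) (env : seq V) t :
  zmod_eval env t = \sum_(i < size env) env`_i *~ zmod_coef t i.
Proof.
elim: t => [|j|t1 IH1 t2 IH2|t IH] /=.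
- by rewrite big1.
- have [jlt|jge] := ltnP j (size env).
    rewrite (bigD1 (Ordinal jlt)) //= eqxx mulr1z big1 ?addr0 // => i ij.
    by case: eqP => // e; move: ij; rewrite -val_eqE /= e eqxx.
  rewrite nth_default // big1 // => i _.
  by case: eqP => // e; move: (ltn_ord i); rewrite -e ltnNge jge.
- by rewrite IH1 IH2 -big_split; apply: eq_bigr => i _; rewrite mulrzDr.
- by rewrite IH -sumrN; apply: eq_bigr => i _; rewrite mulrNz.
Qed.

Lemma zmod_eq (V : zmodType) (env : seq V) t1 t2 :
  all (fun i => zmod_coef t1 i == zmod_coef t2 i) (iota 0 (size env)) ->
  zmod_eval env t1 = zmod_eval env t2.
Proof.
move=> /allP h; rewrite !zmod_evalE; apply: eq_bigr => i _.
by rewrite (eqP (h i _)) // mem_iota /= add0n.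
Qed.

(* Syntactic equality up to the inferred algebraic structures, which need not
   be syntactically equal after rewriting. *)
Ltac zmod_same x y :=
  lazymatch x with
  | ?a * ?b => lazymatch y with ?c * ?d => zmod_same a c; zmod_same b d end
  | ?a ^+ ?n => lazymatch y with ?c ^+ n => zmod_same a c end
  | ?a *: ?b => lazymatch y with ?c *: ?d => unify a c; zmod_same b d end
  | 1 => lazymatch y with 1 => idtac end
  | star ?a => lazymatch y with star ?c => zmod_same a c end
  | _ => constr_eq x y
  end.
Ltac zmod_find x env :=
  match env with
  | ?y :: _ => let _ := match goal with _ => zmod_same x y end in constr:(0%N)
  | _ :: ?e => let n := zmod_find x e in constr:(n.+1)
  end.
Ltac zmod_atoms env t :=
  lazymatch t with
  | 0 => env
  | ?a + ?b => let e := zmod_atoms env a in zmod_atoms e b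
  | - ?a => zmod_atoms env a
  | ?a => match goal with
          | _ => let n := zmod_find a env in env
          | _ => constr:(a :: env)
          end
  end.
Ltac zmod_reify env t :=
  lazymatch t with
  | 0 => constr:(ZZero)
  | ?a + ?b => let x := zmod_reify env a in let y := zmod_reify env b in
               constr:(ZAdd x y)
  | - ?a => let x := zmod_reify env a in constr:(ZOpp x)
  | ?a => let n := zmod_find a env in constr:(ZAtom n)
  end.
Ltac zmod :=
  lazymatch goal with
  | |- @eq ?T ?a ?b =>
    let env := zmod_atoms (@nil T) a in
    let env := zmod_atoms env b in
    let ta := zmod_reify env a in
    let tb := zmod_reify env b in
    exact: (@zmod_eq _ env ta tb isT)
  end.

(** Full distribution leaves signed sums of noncommutative monomials, which [zmod] compares as
    atoms. *)
Ltac ncring := rewrite ?(mulrDl, mulrDr, mulNr, mulrN, mulrA, mul1r, mulr1,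
  mul0r, mulr0, mulr2n); zmod.

(** * Norm and involution of a C*-algebra *)

Section CStarBasics.
Context (R : realType) (B : cstarType R).
Implicit Types (x y z : B) (r s t : R).

Fact star_is_zmod_morphism : zmod_morphism (@star R B).
Proof.
have star0 : star (0 : B) = 0.
  by apply: (addrI (star 0)); rewrite -starD !addr0.
have starN y : star (- y) = - star y.
  by apply: (addrI (star y)); rewrite -starD !subrr.
by move=> x y; rewrite starD starN.
Qed.

HB.instance Definition _ :=
  GRing.isZmodMorphism.Build B B (@star R B) star_is_zmod_morphism.

Lemma star0 : star (0 : B) = 0. Proof. exact: raddf0. Qed.
Lemma starN x : star (- x) = - star x. Proof. exact: raddfN. Qed.
Lemma starB x y : star (x - y) = star x - star y. Proof. exact: raddfB. Qed.

Lemma star1 : star (1 : B) = 1.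
Proof.
by have /(congr1 star) := mul1r (star (1 : B)); rewrite starM starK mul1r.
Qed.

Lemma normcR r : normc r%:C = `|r|.
Proof. by rewrite /normc /= expr0n addr0 sqrtr_sqr. Qed.

Lemma cnorm_scale r x : cnorm (r%:C *: x) = `|r| * cnorm x.
Proof. by rewrite cnormZ normcR. Qed.

Lemma star_scale r x : star (r%:C *: x) = r%:C *: star x.
Proof. by rewrite starZ conj_Creal //; apply/complex_realP; exists r. Qed.

Lemma cnorm0 : cnorm (0 : B) = 0.
Proof. by rewrite -(scale0r (0 : B)) -[0]/(0%:C) cnorm_scale normr0 mul0r. Qed.

Lemma cnormN x : cnorm (- x) = cnorm x.
Proof.
have -> : - x = (-1)%:C *: x by rewrite rmorphN rmorph1 scaleN1r.
by rewrite cnorm_scale normrN1 mul1r.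
Qed.

Lemma cnorm_distC x y : cnorm (x - y) = cnorm (y - x).
Proof. by rewrite -cnormN opprB. Qed.

Lemma cnorm_ge0 x : 0 <= cnorm x.
Proof. by have := ler_cnormD x (- x); rewrite subrr cnorm0 cnormN; lra. Qed.

Lemma cnorm1 : cnorm (1 : B) = 1.
Proof.
have := cnorm_star (1 : B); rewrite star1 mulr1 => h.
have n0 : cnorm (1 : B) != 0 by apply/eqP => /cnorm0_eq0/eqP; rewrite oner_eq0.
by apply: (mulfI n0); rewrite mulr1 -expr2.
Qed.

Lemma cnorm_starE x : cnorm (star x) = cnorm x.
Proof.
have le_star y : cnorm y <= cnorm (star y).
  have [->|n0] := eqVneq (cnorm y) 0; first exact: cnorm_ge0.
  have np : 0 < cnorm y by rewrite lt_neqAle eq_sym n0 cnorm_ge0.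
  by rewrite -(ler_pM2r np) -expr2 -cnorm_star ler_cnormM.
by apply/eqP; rewrite eq_le le_star andbT -{2}(starK x) le_star.
Qed.

Lemma cnorm_triangle x y z : cnorm (x - z) <= cnorm (x - y) + cnorm (y - z).
Proof. by rewrite -(subrKA y x (- z)) ler_cnormD. Qed.

Definition sc r : B := r%:C%:A.

Lemma sc1 : sc 1 = 1. Proof. by rewrite /sc scale1r. Qed.
Lemma scD r s : sc (r + s) = sc r + sc s.
Proof. by rewrite /sc rmorphD scalerDl. Qed.
Lemma scN r : sc (- r) = - sc r.
Proof. by rewrite /sc rmorphN scaleNr. Qed.
Lemma sc_mull r x : sc r * x = r%:C *: x.
Proof. by rewrite /sc -scalerAl mul1r. Qed.
Lemma sc_mulr r x : x * sc r = r%:C *: x.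
Proof. by rewrite /sc -scalerAr mulr1. Qed.
Lemma scM r s : sc (r * s) = sc r * sc s.
Proof. by rewrite sc_mull /sc scalerA rmorphM. Qed.
Lemma star_sc r : star (sc r) = sc r.
Proof. by rewrite /sc star_scale star1. Qed.
Lemma cnorm_sc r : cnorm (sc r) = `|r|.
Proof. by rewrite /sc cnorm_scale cnorm1 mulr1. Qed.
Lemma comm_sc r x : x * sc r = sc r * x.
Proof. by rewrite sc_mull sc_mulr. Qed.

Lemma cnorm_small_eq0 x : (forall e, 0 < e -> cnorm x <= e) -> x = 0.
Proof.
move=> h; apply: cnorm0_eq0; apply/eqP; rewrite eq_le cnorm_ge0 andbT.
by apply/ler_addgt0Pl => e e0; rewrite addr0 h.
Qed.

Definition herm x := star x = x.

Lemma hermX x n : herm x -> herm (x ^+ n).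
Proof.
rewrite /herm => hx; elim: n => [|n IH]; first by rewrite expr0 star1.
by rewrite exprS starM IH hx -exprSr exprS.
Qed.

Lemma cnorm_herm2 x : herm x -> cnorm (x ^+ 2) = cnorm x ^+ 2.
Proof. by move=> hx; rewrite -cnorm_star hx. Qed.

Lemma cnorm_herm_pow2 x n : herm x -> cnorm (x ^+ (2 ^ n)) = cnorm x ^+ (2 ^ n).
Proof.
move=> hx; elim: n => [|n IH]; first by rewrite expn0 !expr1.
by rewrite expnSr !exprM -IH cnorm_herm2 //; apply: hermX.
Qed.

Lemma cnormX x n : cnorm (x ^+ n) <= cnorm x ^+ n.
Proof.
elim: n => [|n IH]; first by rewrite !expr0 cnorm1.
rewrite !exprS; apply: le_trans (ler_cnormM _ _) _.
by rewrite ler_wpM2l // cnorm_ge0.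
Qed.

(** The C*-identity settles exponents that are powers of two. For general [n], factor [x ^+ (2 ^ n)]
    through [x ^+ n]: a strict inequality for [x ^+ n] would make the product too small. *)
Lemma cnorm_hermX x n : herm x -> cnorm (x ^+ n) = cnorm x ^+ n.
Proof.
move=> hx; apply/eqP; rewrite eq_le cnormX /=.
have [x0|n0] := eqVneq (cnorm x) 0.
  by rewrite (cnorm0_eq0 _ x0) cnorm0; case: n => [|n];
    rewrite ?expr0 ?cnorm1 // !expr0n cnorm0.
have xp : 0 < cnorm x by rewrite lt_neqAle eq_sym n0 cnorm_ge0.
have nle : (n <= 2 ^ n)%N by rewrite ltnW // ltn_expl.
have := cnorm_herm_pow2 n hx; rewrite -(subnK nle) !exprD => e.
have xe : 0 < cnorm x ^+ (2 ^ n - n) by rewrite exprn_gt0.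
rewrite -(ler_pM2l xe) -e; apply: le_trans (ler_cnormM _ _) _.
by rewrite ler_wpM2r ?cnorm_ge0 // cnormX.
Qed.

End CStarBasics.

(** * Square roots and the positive cone of a C*-algebra *)

Section SquareRoots.
Context (R : realType) (B : cstarType R).
Implicit Types (a b c d h p x y z : B) (r s t e : R).

Lemma expr_lt_eps r e : 0 <= r < 1 -> 0 < e -> exists k, r ^+ k < e.
Proof.
move=> /andP[r0 r1] e0.
have /cvgrPdist_lt /(_ e e0) [k _ /(_ k (leqnn k))] :
  (fun n => r ^+ n) @ \oo --> (0 : R) by apply: cvg_expr; rewrite ger0_norm.
by rewrite sub0r normrN ger0_norm ?exprn_ge0 //; exists k.
Qed.

Lemma cnorm_cvgP (v : nat -> B) l :
  (fun n => cnorm (v n - l)) @ \oo --> (0 : R) <->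
  (forall e, 0 < e -> exists n0, forall n, (n0 <= n)%N -> cnorm (v n - l) < e).
Proof.
split=> [/cvgrPdist_lt h e /h [n0 _ h0]|h].
  by exists n0 => n /h0; rewrite sub0r normrN ger0_norm // cnorm_ge0.
apply/cvgrPdist_lt => e /h [n0 h0]; exists n0 => //= n /h0.
by rewrite sub0r normrN ger0_norm // cnorm_ge0.
Qed.

(** Two consecutive terms are made close to the limit because the fixed point argument below
    compares [g (v n)], which is [v n.+1], with it. *)
Lemma geometric_limit (v : nat -> B) r : 0 <= r < 1 ->
  (forall k j, cnorm (v (k + j)%N - v k) <= r ^+ k) ->
  exists l, forall e, 0 < e -> exists n, cnorm (v n - l) < e /\
    cnorm (v n.+1 - l) < e.
Proof.
move=> r01 vr; have [|l /cnorm_cvgP vl] := cnorm_complete v.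
  move=> e e0; have e20 : 0 < e / 2 by rewrite divr_gt0.
  have [k hk] := expr_lt_eps r01 e20; exists k => m n km kn.
  apply: le_lt_trans (cnorm_triangle _ (v k) _) _.
  rewrite (cnorm_distC (v k)) -(subnKC km) -(subnKC kn).
  by have := vr k (m - k)%N; have := vr k (n - k)%N; lra.
exists l => e /vl [n h]; exists n; split; apply: h => //.
Qed.

(** The equation says that [1 - d] is a square root of [1 - x]. Equivalently [d] is fixed by [g],
    which preserves the ball of radius [r] and is [r]-Lipschitz there. Iterating from 0 keeps every
    term hermitian if [x] is, and commuting with whatever commutes with [x]; both pass to the
    limit. *)
Lemma sqrt_fixpoint x r : cnorm x <= r -> r < 1 ->
  exists d, [/\ d * d + x = 2%:R * d, cnorm d <= r, herm x -> herm d
    & forall y, y * x = x * y -> y * d = d * y].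
Proof.
move=> xr r1; have r0 : 0 <= r := le_trans (cnorm_ge0 x) xr.
pose g d := (2^-1)%:C *: (x + d * d); pose v n := iter n g 0.
have cg d : cnorm (g d) <= (cnorm x + cnorm d ^+ 2) / 2.
  rewrite cnorm_scale ger0_norm ?invr_ge0 // mulrC ler_wpM2r ?invr_ge0 //.
  by apply: le_trans (ler_cnormD _ _) _; rewrite lerD2l expr2 ler_cnormM.
have vr n : cnorm (v n) <= r.
  elim: n => [|n IH]; first by rewrite /v /= cnorm0.
  apply: le_trans (cg _) _; have := cnorm_ge0 (v n); nra.
have gB a b : cnorm a <= r -> cnorm b <= r ->
    cnorm (g a - g b) <= r * cnorm (a - b).
  move=> ar br; rewrite -scalerBr cnorm_scale ger0_norm ?invr_ge0 //.
  have -> : x + a * a - (x + b * b) = a * (a - b) + (a - b) * b.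
    by ncring.
  have := ler_cnormD (a * (a - b)) ((a - b) * b).
  have := ler_cnormM a (a - b); have := ler_cnormM (a - b) b.
  have := cnorm_ge0 (a - b); nra.
have vgeo k j : cnorm (v (k + j)%N - v k) <= r ^+ k.
  elim: k => [|k IH].
    by rewrite subr0 expr0; apply: le_trans (vr _) (ltW r1).
  rewrite addSn exprS; apply: le_trans (gB _ _ (vr _) (vr _)) _.
  by rewrite ler_wpM2l.
have [|l vl] := geometric_limit _ vgeo; first by rewrite r0.
have lr : cnorm l <= r.
  apply/ler_addgt0Pl => e /vl [n [h _]]; rewrite addrC.
  have := ler_cnormD (l - v n) (v n); rewrite subrK cnorm_distC.
  by have := vr n; lra.
have lfix : g l = l.
  apply/eqP; rewrite -subr_eq0; apply/eqP/cnorm_small_eq0 => e e0.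
  have e20 : 0 < e / 2 by rewrite divr_gt0.
  have [n [h1 h2]] := vl _ e20.
  have := cnorm_triangle (g l) (v n.+1) l.
  have := gB l (v n) lr (vr n); rewrite (cnorm_distC l) /=.
  by have := cnorm_ge0 (v n - l); nra.
exists l; split => //.
- rewrite -{3}lfix /g addrC mulr_natl -scaler_nat scalerA.
  have -> : 2%:R * (2^-1)%:C = 1 :> R[i].
    by rewrite -(rmorph_nat (real_complex R)) -rmorphM mulfV ?pnatr_eq0.
  by rewrite scale1r.
- move=> hx; have vh n : herm (v n).
    elim: n => [|n IH]; first by rewrite /herm star0.
    by rewrite /herm /= star_scale starD starM hx IH.
  apply/eqP; rewrite -subr_eq0; apply/eqP/cnorm_small_eq0 => e e0.
  have e20 : 0 < e / 2 by rewrite divr_gt0.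
  have [n [h1 _]] := vl _ e20.
  have := cnorm_triangle (star l) (v n) l.
  have -> : star l - v n = star (l - v n) by rewrite starB vh.
  by rewrite cnorm_starE (cnorm_distC l); lra.
- move=> y yx; have yv n : y * v n = v n * y.
    elim: n => [|n IH]; first by rewrite mulr0 mul0r.
    by rewrite /= -scalerAr -scalerAl mulrDr mulrDl yx mulrA IH -mulrA IH mulrA.
  apply/eqP; rewrite -subr_eq0; apply/eqP/cnorm_small_eq0 => e e0.
  have yp : 0 < 2 * cnorm y + 1 by have := cnorm_ge0 y; lra.
  have [n [h1 _]] := vl (e / (2 * cnorm y + 1)) (divr_gt0 e0 yp).
  have -> : y * l - l * y = (v n - l) * y - y * (v n - l).
    by move: yv => /(_ n) yv; rewrite mulrBl mulrBr yv; zmod.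
  have := ler_cnormD ((v n - l) * y) (- (y * (v n - l))); rewrite cnormN.
  have := ler_cnormM (v n - l) y; have := ler_cnormM y (v n - l).
  move: h1; rewrite ltr_pdivlMr //; have := cnorm_ge0 y.
  by have := cnorm_ge0 (v n - l); nra.
Qed.

Lemma sqrt_1sub x : herm x -> cnorm x < 1 ->
  exists c, [/\ herm c, c * c = 1 - x
    & forall y, y * x = x * y -> y * c = c * y].
Proof.
move=> hx x1; have [d [dd _ hd dc]] := sqrt_fixpoint (lexx _) x1.
exists (1 - d); split=> [||y /dc yd].
- by rewrite /herm starB star1 hd.
- have -> : x = d + d - d * d by rewrite -mulr2n -mulr_natl -dd; zmod.
  by ncring.
- by rewrite mulrBl mulrBr mul1r mulr1 yd.
Qed.

(** The element [u = h + 'i *: c] satisfies [star u * u = 1], so it has norm 1, and [c] is its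
    imaginary part. *)
Lemma half_cnorm_le h c : herm h -> herm c -> h * c = c * h ->
  h * h + c * c = 1 -> cnorm c <= 1.
Proof.
move=> hh hc comm e1.
pose u := h + 'i *: c; have su : star u = h - 'i *: c.
  by rewrite /u starD starZ hh hc /= conjCi scaleNr.
have u1 : cnorm u = 1.
  apply/eqP; rewrite -(@eqrXn2 _ 2) ?cnorm_ge0 // -cnorm_star su /u.
  have ii : 'i * 'i = - 1 :> R[i] by rewrite -expr2 sqrCi.
  suff -> : (h - 'i *: c) * (h + 'i *: c) = 1 by rewrite cnorm1 expr1n.
  rewrite -e1 mulrDr !mulrBl -!scalerAl -!scalerAr comm scalerA ii scaleN1r.
  by zmod.
have n1 : normc ('i : R[i]) = 1 by apply: complexI; exact: (@normCi R[i]).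
have := ler_cnormD u (- star u); rewrite cnormN cnorm_starE u1 su /u.
have -> : h + 'i *: c - (h - 'i *: c) = 'i *: c + 'i *: c by zmod.
rewrite -scalerDr cnormZ n1 mul1r -mulr2n -scaler_nat.
rewrite -(rmorph_nat (real_complex R)) cnorm_scale ger0_norm //; lra.
Qed.

End SquareRoots.

Section Cone.
Context (R : realType) (B : cstarType R).
Implicit Types (a b c d h p x y z : B) (r s t e : R).

Lemma herm1 : herm (1 : B). Proof. exact: star1. Qed.
Lemma herm_sc r : herm (sc B r). Proof. exact: star_sc. Qed.
Lemma hermD x y : herm x -> herm y -> herm (x + y).
Proof. by rewrite /herm starD => -> ->. Qed.
Lemma hermB x y : herm x -> herm y -> herm (x - y).
Proof. by rewrite /herm starB => -> ->. Qed.
Lemma herm_scale r x : herm x -> herm (r%:C *: x).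
Proof. by rewrite /herm star_scale => ->. Qed.
Lemma hermM x y : herm x -> herm y -> x * y = y * x -> herm (x * y).
Proof. by rewrite /herm starM => -> -> ->. Qed.
Lemma herm_sqr x : herm x -> herm (x * x).
Proof. by move=> hx; apply: hermM. Qed.

(* Equivalent to positivity of the spectrum, but it can be handled without
   spectral theory: the cone is visibly closed under addition. *)
Definition pos a := herm a /\ exists t, cnorm (sc B t - a) <= t.

Lemma posD a b : pos a -> pos b -> pos (a + b).
Proof.
move=> [ha [t ht]] [hb [s hs]]; split; first exact: hermD.
exists (t + s); have -> : sc B (t + s) - (a + b) = sc B t - a + (sc B s - b).
  by rewrite scD; zmod.
by apply: le_trans (ler_cnormD _ _) _; rewrite lerD.
Qed.

Lemma pos_scale r a : 0 <= r -> pos a -> pos (r%:C *: a).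
Proof.
move=> r0 [ha [t ht]]; split; first exact: herm_scale.
exists (r * t); have -> : sc B (r * t) - r%:C *: a = r%:C *: (sc B t - a).
  by rewrite scalerBr scM sc_mull.
by rewrite cnorm_scale ger0_norm // ler_wpM2l.
Qed.

Lemma pos_sub_norm a r : herm a -> cnorm a <= r -> pos (sc B r - a).
Proof.
move=> ha ar; split; first by apply: hermB => //; apply: herm_sc.
by exists r; rewrite opprB addrCA subrr addr0.
Qed.

Lemma cnorm_sqr_le x : cnorm (x * x) <= cnorm x ^+ 2.
Proof. by rewrite expr2 ler_cnormM. Qed.

Lemma cnorm_sqr x : herm x -> cnorm (x * x) = cnorm x ^+ 2.
Proof. by move=> hx; rewrite -expr2 cnorm_herm2. Qed.

(** A root [c] of [1 - h * h] commutes with [h], so [half_cnorm_le] applies to the pair. *)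
Lemma cnorm_1sub_sqr h : herm h -> cnorm h < 1 -> cnorm (1 - h * h) <= 1.
Proof.
move=> hh h1; have hh1 : cnorm (h * h) < 1.
  rewrite cnorm_sqr //; have := cnorm_ge0 h; nra.
have [c [hc cE cc]] := sqrt_1sub (herm_sqr hh) hh1.
have c1 : cnorm c <= 1.
  apply: (@half_cnorm_le _ _ h) => //; first by apply: cc; rewrite mulrA.
  by rewrite cE; zmod.
rewrite -cE; apply: le_trans (cnorm_sqr_le _) _; have := cnorm_ge0 c; nra.
Qed.

Lemma cnorm_sub_sqr h r : herm h -> cnorm h < r ->
  cnorm (sc B (r ^+ 2) - h * h) <= r ^+ 2.
Proof.
move=> hh hr; have r0 : 0 < r := le_lt_trans (cnorm_ge0 h) hr.
have rn0 : r != 0 by rewrite gt_eqF.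
pose k := (r^-1)%:C *: h.
have kh : h = r%:C *: k by rewrite scalerA -rmorphM mulfV // scale1r.
have -> : sc B (r ^+ 2) - h * h = (r ^+ 2)%:C *: (1 - k * k).
  by rewrite kh scalerBr -scalerAl -scalerAr scalerA -rmorphM -expr2.
rewrite cnorm_scale ger0_norm ?sqr_ge0 // ler_piMr ?sqr_ge0 //.
apply: cnorm_1sub_sqr; first exact: herm_scale.
by rewrite cnorm_scale ger0_norm ?invr_ge0 ?ltW // mulrC ltr_pdivrMr ?mul1r.
Qed.

Lemma pos_sqr h : herm h -> pos (h * h).
Proof.
move=> hh; split; first exact: herm_sqr.
by exists ((cnorm h + 1) ^+ 2); apply: cnorm_sub_sqr; rewrite // ltrDl.
Qed.

(** Here [a + e] is [t + e] times [1 - x]. The shift by [e] makes the norm of [x] strictly less than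
    1, as the contraction requires. *)
Lemma pos_sqrt a e : pos a -> 0 < e -> exists c,
  [/\ herm c, c * c = a + sc B e & forall y, y * a = a * y -> y * c = c * y].
Proof.
move=> [ha [t ht]] e0; have t0 : 0 <= t := le_trans (cnorm_ge0 _) ht.
have te : 0 < t + e by lra.
have ten0 : t + e != 0 by rewrite gt_eqF.
pose x := ((t + e)^-1)%:C *: (sc B t - a).
have hx : herm x by apply: herm_scale; apply: hermB => //; exact: herm_sc.
have x1 : cnorm x < 1.
  rewrite cnorm_scale ger0_norm ?invr_ge0 ?ltW // mulrC ltr_pdivrMr //; lra.
have [c [hc cc comm]] := sqrt_1sub hx x1.
have se : 0 <= Num.sqrt (t + e) by [].
exists ((Num.sqrt (t + e))%:C *: c); split=> [||y ya].
- exact: herm_scale.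
- rewrite -scalerAl -scalerAr scalerA -rmorphM -expr2 sqr_sqrtr ?ltW // cc.
  rewrite scalerBr scalerA -rmorphM mulfV // scale1r -/(sc B _) scD.
  by zmod.
- rewrite -scalerAl -scalerAr comm // /x -scalerAl -scalerAr mulrBr mulrBl ya.
  by rewrite comm_sc.
Qed.

(** This replaces the unknown witness [t] of [pos a] by any bound of the norm: [a + e] is a square
    [c * c] with [cnorm c ^+ 2 < s + 2 * e]. Removing the surplus scalar [e] again brings the total
    error to [3 * e]. *)
Lemma pos_norm a s : pos a -> cnorm a <= s -> cnorm (sc B s - a) <= s.
Proof.
move=> pa as_; have s0 := le_trans (cnorm_ge0 _) as_.
apply/ler_addgt0Pl => e' e'0.
have [e e0 ->] : exists2 e, 0 < e & e' = 3 * e.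
  by exists (e' / 3); [rewrite divr_gt0|field].
have [c [hc cc _]] := pos_sqrt pa e0.
have s2e : 0 < s + 2 * e by lra.
have cs : cnorm c < Num.sqrt (s + 2 * e).
  rewrite -[cnorm c]ger0_norm ?cnorm_ge0 // -sqrtr_sqr ltr_sqrt //.
  rewrite -(cnorm_sqr hc) cc; have := ler_cnormD a (sc B e).
  by rewrite cnorm_sc gtr0_norm //; lra.
have := cnorm_sub_sqr hc cs; rewrite sqr_sqrtr ?(ltW s2e) // cc.
have -> : sc B s - a = sc B (s + 2 * e) - (a + sc B e) - sc B e.
  have -> : s + 2 * e = s + e + e by ring.
  by rewrite !scD; zmod.
move: (sc B _ - _) => w hw; have := ler_cnormD w (- sc B e).
by rewrite cnormN cnorm_sc gtr0_norm //; lra.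
Qed.

(** By [pos_norm] the approximants share a witness near [cnorm a], so the defining inequality passes
    to the limit. *)
Lemma pos_closed a : herm a ->
  (forall e, 0 < e -> exists2 b, pos b & cnorm (b - a) <= e) -> pos a.
Proof.
move=> ha h; split=> //; exists (cnorm a); apply/ler_addgt0Pl => e' e'0.
have e0 : 0 < e' / 3 by rewrite divr_gt0.
have [b pb ba] := h _ e0.
have bn : cnorm b <= cnorm a + e' / 3.
  by have := ler_cnormD (b - a) a; rewrite subrK; lra.
have := pos_norm pb bn.
have -> : sc B (cnorm a) - a =
    (sc B (cnorm a + e' / 3) - b) + ((b - a) - sc B (e' / 3)).
  by rewrite scD; zmod.
move: (_ - b) => w hw.
have := ler_cnormD w (b - a - sc B (e' / 3)).
have := ler_cnormD (b - a) (- sc B (e' / 3)).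
by rewrite cnormN cnorm_sc gtr0_norm //; lra.
Qed.

(** If [c] is a root of [p + e'], then [x * c] is hermitian and its square approximates
    [x * p * x]. *)
Lemma pos_conj_comm p x : pos p -> herm x -> x * p = p * x -> pos (x * p * x).
Proof.
move=> pp hx xp; apply: pos_closed.
  by rewrite /herm !starM hx (proj1 pp) mulrA.
move=> e e0; have xe : 0 < cnorm x ^+ 2 + 1 by have := sqr_ge0 (cnorm x); lra.
pose e' := e / (cnorm x ^+ 2 + 1); have e'0 : 0 < e' by rewrite divr_gt0.
have [c [hc cc comm]] := pos_sqrt pp e'0.
have xc := comm x xp; exists ((x * c) * (x * c)).
  by apply: pos_sqr; apply: hermM.
have -> : x * c * (x * c) - x * p * x = e'%:C *: (x * x).
  rewrite {2}xc mulrA -(mulrA x c c) cc mulrDr mulrDl sc_mulr scalerAl.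
  by zmod.
rewrite cnorm_scale gtr0_norm // cnorm_sqr //.
rewrite /e' mulrAC ler_pdivrMr //; nra.
Qed.

(** A crude bound, sharpened next by taking powers. With [s] the norm of [a], the difference of the
    squares of [s + a] and [s - a] is [4 * s] times [a], whence
    [4 * s ^+ 2 <= (s + 1) ^+ 2 + s ^+ 2]. *)
Lemma cnorm_le2 a : pos a -> pos (1 - a) -> cnorm a <= 2.
Proof.
move=> pa p1a; set s := cnorm a; have s0 : 0 <= s := cnorm_ge0 a.
have sa : cnorm (sc B s - a) <= s by apply: pos_norm.
have sa1 : cnorm (sc B s + a) <= s + 1.
  have -> : sc B s + a = sc B (s + 1) - (1 - a) by rewrite scD sc1; zmod.
  apply: pos_norm => //; have := ler_cnormD (- a) 1.
  by rewrite cnormN cnorm1 addrC.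
have e1 : (sc B s + a) * (sc B s + a) - (sc B s - a) * (sc B s - a) =
    (4 * s)%:C *: a.
  have -> : 4 * s = s + s + (s + s) by ring.
  rewrite !rmorphD !scalerDl -!sc_mull !mulrDl !mulrDr !mulNr !mulrN.
  by rewrite (comm_sc s a); zmod.
have := ler_cnormD ((sc B s + a) * (sc B s + a))
  (- ((sc B s - a) * (sc B s - a))).
rewrite e1 cnorm_scale cnormN ger0_norm ?mulr_ge0 // -/s.
have := cnorm_sqr_le (sc B s + a); have := cnorm_sqr_le (sc B s - a).
have := cnorm_ge0 (sc B s + a); have := cnorm_ge0 (sc B s - a).
by nra.
Qed.

Lemma pow_unbounded r s : 1 < r -> exists n, s < r ^+ n.
Proof.
move=> r1; have r0 : 0 < r by lra.
have [s1|s1] := leP s 0; first by exists 0%N; rewrite expr0; lra.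
have [||k hk] := @expr_lt_eps R r^-1 s^-1.
- by rewrite invr_ge0 ltW //= invf_lt1.
- by rewrite invr_gt0.
by exists k; move: hk; rewrite exprVn ltf_pV2 // posrE exprn_gt0.
Qed.

(** Both hypotheses are inherited by the powers [a ^+ (2 ^ n)], whose norms would be unbounded if
    [cnorm a > 1], against [cnorm_le2]. *)
Lemma cnorm_le1 a : pos a -> pos (1 - a) -> cnorm a <= 1.
Proof.
move=> pa p1a; rewrite leNgt; apply/negP => a1.
have h n : pos (a ^+ (2 ^ n)) /\ pos (1 - a ^+ (2 ^ n)).
  elim: n => [|n [IH1 IH2]]; first by rewrite expn0 expr1.
  rewrite expnSr exprM; move: (a ^+ _) IH1 IH2 => b pb p1b.
  have hb := proj1 pb; have h1b := proj1 p1b.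
  have cb : b * (1 - b) = (1 - b) * b by ncring.
  rewrite expr2; split; first exact: pos_sqr.
  have -> : 1 - b * b = (1 - b) + (b * (1 - b) * b + (1 - b) * b * (1 - b)).
    by ncring.
  by apply: posD => //; apply: posD; apply: pos_conj_comm.
have [n hn] := pow_unbounded 2 a1; have [h1 h2] := h n.
have := cnorm_le2 h1 h2; rewrite cnorm_herm_pow2; last exact: (proj1 pa).
rewrite leNgt => /negP; apply; apply: lt_le_trans hn _.
by apply: ler_weXn2l; [exact: ltW|rewrite ltnW // ltn_expl].
Qed.

Lemma cnorm_le_pos a r : 0 < r -> pos a -> pos (sc B r - a) -> cnorm a <= r.
Proof.
move=> r0 pa pra; have rn0 : r != 0 by rewrite gt_eqF.
have ri0 : 0 <= r^-1 by rewrite invr_ge0 ltW.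
have : cnorm (r^-1%:C *: a) <= 1.
  apply: cnorm_le1; first exact: pos_scale.
  have -> : 1 - r^-1%:C *: a = r^-1%:C *: (sc B r - a).
    by rewrite scalerBr scalerA -rmorphM mulVf // scale1r.
  exact: pos_scale.
by rewrite cnorm_scale ger0_norm // mulrC ler_pdivrMr // mul1r.
Qed.

(** It suffices to bound [h * h], and [1 - h * h] is positive: the commuting factors [1 - h] and
    [1 + h], each conjugated by the other, add up to twice it. *)
Lemma cnorm_herm_le1 h : pos (1 - h) -> pos (1 + h) -> cnorm h <= 1.
Proof.
move=> p1 p2; have hh : herm h.
  have -> : h = 1 - (1 - h) by zmod.
  by apply: hermB; [exact: herm1|exact: (proj1 p1)].
have c12 : (1 - h) * (1 + h) = (1 + h) * (1 - h) by ncring.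
suff : cnorm (h * h) <= 1.
  by rewrite cnorm_sqr // -{1}(expr1n R 2) ler_pXn2r ?nnegrE ?cnorm_ge0.
apply: cnorm_le1; first exact: pos_sqr.
have -> : 1 - h * h = 2^-1%:C *:
    ((1 - h) * (1 + h) * (1 - h) + (1 + h) * (1 - h) * (1 + h)).
  have -> : (1 - h) * (1 + h) * (1 - h) + (1 + h) * (1 - h) * (1 + h) =
     2%:C *: (1 - h * h).
    by rewrite (_ : 2 = 1 + 1) // rmorphD rmorph1 scalerDl !scale1r; ncring.
  by rewrite scalerA -rmorphM mulVf ?pnatr_eq0 // scale1r.
apply: pos_scale; first by rewrite invr_ge0.
apply: posD; apply: pos_conj_comm => //; [exact: (proj1 p1)|exact: (proj1 p2)].
Qed.

End Cone.

(** * Positivity of [star y * y] *)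

Section StarSquares.
Context (R : realType) (B : cstarType R).
Implicit Types (a b c d h p w x y z : B) (r s t e : R).

Lemma two_scale x : 2%:C *: x = x + x.
Proof. by rewrite (_ : 2 = 1 + 1) // rmorphD rmorph1 scalerDl !scale1r. Qed.

Lemma half_scaleK x : 2^-1%:C *: (x + x) = x.
Proof. by rewrite -two_scale scalerA -rmorphM mulVf ?pnatr_eq0 // scale1r. Qed.

(** Twice this element is [h * h + k * k] for hermitian [h] and [k]; neither summand is yet known to
    be positive by itself. *)
Lemma pos_starM_add z : pos (star z * z + z * star z).
Proof.
pose h := z + star z; pose k := - 'i *: (z - star z).
have hh : herm h by rewrite /herm /h starD starK addrC.
have hk : herm k.
  by rewrite /herm /k starZ starB starK rmorphN /= conjCi opprK scaleNr
    -scalerN opprB.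
have kk : k * k = - ((z - star z) * (z - star z)).
  rewrite /k -scalerAl -scalerAr scalerA mulrNN -expr2 sqrCi scaleN1r.
  by [].
have -> : star z * z + z * star z = 2^-1%:C *: (h * h + k * k).
  rewrite -[LHS]half_scaleK kk /h; congr (_ *: _); ncring.
by apply: pos_scale; [rewrite invr_ge0|apply: posD; apply: pos_sqr].
Qed.

(** Passing from [m] to [m.+1] adds [w ^+ m * (1 - w) ^+ 2], which is a square because [w] is
    one. *)
Lemma pos_weight d w m : herm d -> w = d * d -> pos (1 - w ^+ m + w ^+ m.+1).
Proof.
move=> hd wd; elim: m => [|m IH].
  by rewrite expr0 expr1 subrr add0r wd; apply: pos_sqr.
have wdm : w ^+ m = d ^+ m * d ^+ m by rewrite wd -expr2 -exprM mulnC exprM.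
have dw : GRing.comm (d ^+ m) (1 - w).
  by apply/commr_sym/commrX; rewrite wd /GRing.comm; ncring.
have -> : 1 - w ^+ m.+1 + w ^+ m.+2 = 1 - w ^+ m + w ^+ m.+1 +
    (d ^+ m * (1 - w)) * (d ^+ m * (1 - w)).
  have -> : (d ^+ m * (1 - w)) * (d ^+ m * (1 - w)) =
      w ^+ m * ((1 - w) * (1 - w)).
    by rewrite wdm -mulrA (mulrA (1 - w)) -dw !mulrA.
  have -> : w ^+ m.+1 = w ^+ m * w by rewrite exprSr.
  have -> : w ^+ m.+2 = w ^+ m * w * w by rewrite !exprSr.
  ncring.
apply: posD => //; apply: pos_sqr; apply: hermM => //.
- exact: hermX.
- by apply: hermB; [exact: herm1|rewrite wd; exact: herm_sqr].
Qed.

(* Otherwise w = 1 - star y * y has norm s > 1.  For z = y * w ^+ n the element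
   z * star z is at most 1, so the positivity of star z * z + z * star z
   bounds w ^+ (2n + 1), of norm s ^+ (2n + 1), by 1 + s ^+ (2n). *)
Lemma cnorm_1sub_starM y : cnorm y < 1 -> cnorm (1 - star y * y) <= 1.
Proof.
move=> y1; set a := star y * y; pose b := y * star y.
have ha : herm a by rewrite /herm /a starM starK.
have hb : herm b by rewrite /herm /b starM starK.
have y2 : cnorm y ^+ 2 < 1 by have := cnorm_ge0 y; nra.
have [c [hc cE cc]] : exists c, [/\ herm c, c * c = 1 - a
    & forall x, x * a = a * x -> x * c = c * x].
  by apply: sqrt_1sub => //; rewrite cnorm_star.
have [d [hd dE _]] : exists d, [/\ herm d, d * d = 1 - b
    & forall x, x * b = b * x -> x * d = d * x].
  by apply: sqrt_1sub => //; rewrite /b -{1}(starK y) cnorm_star cnorm_starE.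
set w := 1 - a; pose v := 1 - b.
have {}cE : c * c = w := cE.
have hw : herm w by apply: hermB => //; exact: herm1.
have aw : GRing.comm a w by rewrite /GRing.comm mulrBr mulrBl mul1r mulr1.
have cw : GRing.comm c w by rewrite /GRing.comm -cE mulrA.
have yw n : y * w ^+ n = v ^+ n * y.
  elim: n => [|n IH]; first by rewrite !expr0 mulr1 mul1r.
  rewrite !exprSr mulrA IH -!mulrA; congr (_ * _).
  by rewrite /w /v /a /b; ncring.
have key n : pos (1 + w ^+ (2 * n) - w ^+ (2 * n).+1).
  have -> : 1 + w ^+ (2 * n) - w ^+ (2 * n).+1 = 1 - v ^+ (2 * n) +
    v ^+ (2 * n).+1 + (star (y * w ^+ n) * (y * w ^+ n) +
      (y * w ^+ n) * star (y * w ^+ n)).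
    have hwn : star (w ^+ n) = w ^+ n by apply: hermX.
    have -> : star (y * w ^+ n) * (y * w ^+ n) = w ^+ (2 * n) - w ^+ (2 * n).+1.
      rewrite starM hwn -mulrA (mulrA (star y)) -/a.
      rewrite (commrX n aw) mulrA -exprD addnn -mul2n exprSr.
      by rewrite (_ : a = 1 - w) ?mulrBr ?mulr1 // /w; zmod.
    have -> : y * w ^+ n * star (y * w ^+ n) = v ^+ (2 * n) - v ^+ (2 * n).+1.
      rewrite starM hwn -mulrA (mulrA (w ^+ n)) -exprD addnn -mul2n mulrA yw.
      rewrite -mulrA -/b exprSr.
      by rewrite (_ : b = 1 - v) ?mulrBr ?mulr1 // /v; zmod.
    by zmod.
  by apply: posD; [exact: (@pos_weight d)|exact: pos_starM_add].
rewrite leNgt; apply/negP; set s := cnorm w => s1.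
have bound n : s ^+ (2 * n).+1 <= 1 + s ^+ (2 * n).
  rewrite -[s ^+ _.+1]cnorm_hermX //; apply: cnorm_le_pos.
  - by rewrite ltr_wpDr ?exprn_ge0 // cnorm_ge0.
  - have -> : w ^+ (2 * n).+1 = (c * w ^+ n) * (c * w ^+ n).
      have cwn := commrX n cw; rewrite {2}cwn mulrA -(mulrA c) -exprD addnn.
      by rewrite -mul2n (commrX _ cw) -mulrA cE -exprSr.
    apply: pos_sqr; apply: hermM => //; [exact: hermX|exact: commrX].
  - have -> : sc B (1 + s ^+ (2 * n)) - w ^+ (2 * n).+1 =
      (1 + w ^+ (2 * n) - w ^+ (2 * n).+1) +
      (sc B (s ^+ (2 * n)) - w ^+ (2 * n)) by rewrite scD sc1; zmod.
    apply: posD => //; apply: pos_sub_norm; first exact: hermX.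
    exact: cnormX.
(* [bound] says that [s ^+ (2 * n) * (s - 1)] never exceeds 1, which fails for large [n]. *)
have s21 : 1 < s ^+ 2 by nra.
have [n hn] := pow_unbounded (s - 1)^-1 s21.
have := bound n; rewrite exprS exprM; move: hn.
by rewrite -[X in X < _]mul1r ltr_pdivrMr ?subr_gt0 //; nra.
Qed.

Lemma pos_starM y : pos (star y * y).
Proof.
split; first by rewrite /herm starM starK.
pose r := cnorm y + 1; have r0 : 0 < r by have := cnorm_ge0 y; rewrite /r; lra.
exists (r ^+ 2); pose k := (r^-1)%:C *: y.
have yk : y = r%:C *: k by rewrite scalerA -rmorphM mulfV ?gt_eqF // scale1r.
have -> : sc B (r ^+ 2) - star y * y = (r ^+ 2)%:C *: (1 - star k * k).
  rewrite yk star_scale scalerBr -scalerAl -scalerAr scalerA -rmorphM -expr2.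
  by [].
rewrite cnorm_scale ger0_norm ?sqr_ge0 // ler_piMr ?sqr_ge0 //.
apply: cnorm_1sub_starM; rewrite cnorm_scale ger0_norm ?invr_ge0 ?ltW //.
by rewrite mulrC ltr_pdivrMr // mul1r /r ltrDl.
Qed.

End StarSquares.

(** * Norm bounds for unital positive maps *)

Section PositiveMaps.
Context (R : realType) (B D : cstarType R).

Definition positive_map (f : B -> D) := forall x, pos (f (star x * x)).

(** Only [a + e] is known to be a square, so [f a] is reached as a limit of positive elements. *)
Lemma positive_map_pos (f : {linear B -> D}) : positive_map f -> f 1 = 1 ->
  forall a, pos a -> (forall x, herm x -> herm (f x)) -> pos (f a).
Proof.
move=> pf f1 a pa fh; apply: pos_closed; first exact: fh (proj1 pa).
move=> e e0; have [c [hc cc _]] := pos_sqrt pa e0.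
exists (f (c * c)); first by rewrite -{1}hc.
by rewrite -linearB cc addrAC subrr add0r /sc linearZ /= f1 cnorm_scale cnorm1
  mulr1 ger0_norm // ltW.
Qed.

Lemma positive_map_herm (f : {linear B -> D}) : positive_map f -> f 1 = 1 ->
  forall x, herm x -> herm (f x).
Proof.
move=> pf f1 x hx; pose r := cnorm x + 1.
have xr : cnorm x <= r by rewrite lerDl.
have [c [hc cc _]] := pos_sqrt (pos_sub_norm hx xr) (ltr01 : 0 < 1 :> R).
have -> : x = sc B (r + 1) - c * c by rewrite cc !scD; zmod.
rewrite linearB /= /sc linearZ /= f1; apply: hermB; first exact: herm_sc.
by rewrite -{1}hc; apply: (proj1 (pf c)).
Qed.

Lemma cnorm_positive_map_herm (f : {linear B -> D}) : positive_map f ->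
  f 1 = 1 -> forall x, herm x -> cnorm (f x) <= cnorm x.
Proof.
move=> pf f1 x hx.
have pp := positive_map_pos pf f1; have fh := positive_map_herm pf f1.
apply/ler_addgt0Pl => e e0; pose r := e + cnorm x.
have r0 : 0 < r by have := cnorm_ge0 x; rewrite /r; lra.
have rr : cnorm x <= r by rewrite lerDr ltW.
have fsc t : f (sc B t) = sc D t by rewrite /sc linearZ /= f1.
have h : cnorm (r^-1%:C *: f x) <= 1.
  have ri0 : 0 <= r^-1 by rewrite invr_ge0 ltW.
  have e1 : r^-1%:C *: sc D r = 1.
    by rewrite -sc_mull -scM mulVf ?gt_eqF // sc1.
  apply: cnorm_herm_le1.
    have -> : 1 - r^-1%:C *: f x = r^-1%:C *: f (sc B r - x).
      by rewrite linearB /= fsc scalerBr e1.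
    by apply: pos_scale => //; apply: pp => //; apply: pos_sub_norm.
  have -> : 1 + r^-1%:C *: f x = r^-1%:C *: f (sc B r - (- x)).
    by rewrite linearB linearN /= opprK fsc scalerDr e1.
  apply: pos_scale => //; apply: pp => //; apply: pos_sub_norm.
    by rewrite /herm starN hx.
  by rewrite cnormN.
move: h; rewrite cnorm_scale ger0_norm ?invr_ge0 ?(ltW r0) // mulrC ler_pdivrMr //.
by rewrite mul1r.
Qed.

(** The factor 2 is the price of splitting [x] into hermitian parts. Any constant independent of [f]
    serves the approximation argument. *)
Lemma cnorm_positive_map (f : {linear B -> D}) : positive_map f ->
  f 1 = 1 -> forall x, cnorm (f x) <= 2 * cnorm x.
Proof.
move=> pf f1 x; have hb := cnorm_positive_map_herm pf f1.
pose h := x + star x; pose k := 'i *: (x - star x).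
have hh : herm h by rewrite /herm /h starD starK addrC.
have hk : herm k.
  by rewrite /herm /k starZ starB starK /= conjCi scaleNr -scalerN opprB.
have n1 : normc ('i : R[i]) = 1 by apply: complexI; exact: (@normCi R[i]).
have fx : f x = 2^-1%:C *: (f h - 'i *: f k).
  have -> : f h = f x + f (star x) by rewrite /h linearD.
  have -> : 'i *: f k = - (f x - f (star x)).
    by rewrite /k linearZ /= scalerA -expr2 sqrCi scaleN1r linearB.
  by rewrite -[LHS]half_scaleK; congr (_ *: _); zmod.
have hn : cnorm h <= 2 * cnorm x.
  by have := ler_cnormD x (star x); rewrite cnorm_starE -/h; lra.
have kn : cnorm k <= 2 * cnorm x.
  have := ler_cnormD x (- star x); rewrite cnormN cnorm_starE.
  by rewrite /k cnormZ n1 mul1r; lra.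
rewrite fx cnorm_scale ger0_norm ?invr_ge0 //.
have := ler_cnormD (f h) (- ('i *: f k)); rewrite cnormN cnormZ n1 mul1r.
have := hb _ hh; have := hb _ hk; lra.
Qed.

End PositiveMaps.

(** * States *)

Section HahnBanach.
Context (R : realType) (V : lmodType R[i]).
Implicit Types (p q f : V -> R) (x y : V) (r s t : R).

(** Scalars are real although the space is complex: Hahn-Banach is applied to real functionals, and
    complexification comes afterwards. *)
Definition sublinear p := (forall x y, p (x + y) <= p x + p y) /\
  (forall r x, 0 <= r -> p (r%:C *: x) = r * p x).

Lemma sublinear0 p : sublinear p -> p 0 = 0.
Proof. by move=> [_ pZ]; rewrite -(scale0r 0) -[0]/(0%:C) pZ // mul0r. Qed.

Lemma sublinear_lower p x : sublinear p -> - p (- x) <= p x.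
Proof.
by move=> sp; have := proj1 sp x (- x); rewrite subrr sublinear0 //; lra.
Qed.

(** This serves twice, for [directional] and for the infimum of a chain. The minorant [m] makes the
    infima finite. *)
Lemma inf_sublinear (I : Type) (g : I -> V -> R) (m : V -> R) :
  (exists i, g i 0 <= 0) -> (forall i x, m x <= g i x) ->
  (forall i j x y, exists k, g k (x + y) <= g i x + g j y) ->
  (forall i r x, 0 < r -> exists k, g k (r%:C *: x) <= r * g i x) ->
  sublinear (fun x => inf (range (g^~ x))).
Proof.
move=> [i0 gi0] mg gD gZ; pose q x := inf (range (g^~ x)); rewrite -/q.
have qle i x : q x <= g i x by apply: ge_inf; [exists (m x) => _ [j _ <-]|exists i].
have qge x r : (forall i, r <= g i x) -> r <= q x.
  by move=> h; apply: lb_le_inf; [exists (g i0 x), i0|move=> _ [j _ <-]].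
have qD x y : q (x + y) <= q x + q y.
  suff : q (x + y) - q y <= q x by lra.
  apply: (qge x) => i; suff : q (x + y) - g i x <= q y by lra.
  apply: (qge y) => j; have [k hk] := gD i j x y.
  by have := qle k (x + y); lra.
have qZ r x : 0 < r -> q (r%:C *: x) <= r * q x.
  move=> r0; rewrite mulrC -ler_pdivrMr //; apply: (qge x) => i.
  by rewrite ler_pdivrMr // mulrC; have [k] := gZ i r x r0; apply: le_trans.
have q0 : q 0 = 0.
  apply/eqP; rewrite eq_le (le_trans (qle i0 0) gi0) /=.
  by have := qD 0 0; rewrite addr0; lra.
split=> // r x; rewrite le_eqVlt => /orP[/eqP <-|r0].
  by rewrite mul0r scale0r.
apply/eqP; rewrite eq_le qZ //=.
have ri0 : 0 < r^-1 by rewrite invr_gt0.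
have := qZ _ (r%:C *: x) ri0; rewrite scalerA -rmorphM mulVf ?gt_eqF // scale1r.
by rewrite mulrC ler_pdivlMr // mulrC.
Qed.

(** A sublinear minorant of [p] whose value at [- y] is at most [- p y] (take [t = 1]), so a linear
    functional below it must take the value [p y] at [y]. *)
Definition directional p y x :=
  inf (range (fun t : {t : R | 0 <= t} => p (x + (sval t)%:C *: y) - sval t * p y)).

Lemma directional_lower p y : sublinear p ->
  forall (t : {t : R | 0 <= t}) x,
  - p (- x) <= p (x + (sval t)%:C *: y) - sval t * p y.
Proof.
move=> [pD pZ] [t t0] x /=.
have := pD (x + t%:C *: y) (- x).
by rewrite addrC addKr pZ //; lra.
Qed.

Lemma directional_sublinear p y : sublinear p -> sublinear (directional p y).
Proof.
move=> sp; apply: (@inf_sublinear _ _ (fun x => - p (- x))) => /=.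
- exists (exist _ 0 (lexx 0)) => /=.
  by rewrite scale0r addr0 mul0r subr0 sublinear0.
- exact: directional_lower.
- move=> [t t0] [s s0] x z; exists (exist _ (t + s) (addr_ge0 t0 s0)) => /=.
  have := proj1 sp (x + t%:C *: y) (z + s%:C *: y).
  by rewrite addrACA -scalerDl -rmorphD; lra.
- move=> [t t0] r x r0; exists (exist _ (r * t) (mulr_ge0 (ltW r0) t0)) => /=.
  by rewrite rmorphM -scalerA -scalerDr (proj2 sp) ?(ltW r0) // mulrBr mulrA.
Qed.

Lemma directional_le p y t x : sublinear p -> 0 <= t ->
  directional p y x <= p (x + t%:C *: y) - t * p y.
Proof.
move=> sp t0; apply: ge_inf; last by exists (exist _ t t0).
by exists (- p (- x)) => _ [u _ <-]; apply: directional_lower.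
Qed.

(** A minimal [p] equals each [directional p y]; at [t = 1] this is the missing inequality
    [p x + p y <= p (x + y)]. *)
Lemma minimal_sublinear_linear p : sublinear p ->
  (forall q, sublinear q -> (forall x, q x <= p x) -> q = p) ->
  (forall x y, p (x + y) = p x + p y) /\
  (forall r x, p (r%:C *: x) = r * p x).
Proof.
move=> sp mp; have pdir y : directional p y = p.
  apply: mp; first exact: directional_sublinear.
  move=> x; have := @directional_le p y 0 x sp (lexx 0).
  by rewrite scale0r addr0 mul0r subr0.
have pD x y : p (x + y) = p x + p y.
  apply/eqP; rewrite eq_le (proj1 sp) /=.
  have := @directional_le p y 1 x sp ler01; rewrite pdir scale1r mul1r; lra.
split=> // r x; have [r0|r0] := leP 0 r; first exact: (proj2 sp).
have pN y : p (- y) = - p y.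
  by have := pD y (- y); rewrite subrr sublinear0 //; lra.
rewrite -[r]opprK rmorphN scaleNr pN (proj2 sp); last by lra.
by rewrite !mulNr.
Qed.

Lemma hahn_banach p y : sublinear p -> exists f,
  [/\ forall x z, f (x + z) = f x + f z,
      forall r x, f (r%:C *: x) = r * f x,
      forall x, f x <= p x & f y = p y].
Proof.
move=> sp; have sp' := directional_sublinear y sp.
pose T := {q | sublinear q /\ forall x, q x <= directional p y x}.
(* The order is reversed so that the maximal elements of Zorn's lemma are minimal functionals. *)
pose below (q1 q2 : T) := `[< forall x, sval q2 x <= sval q1 x >].
have [|||A tA|m mmin] := @Zorn T below.
- by move=> q; apply/asboolP.
- move=> q1 q2 q3 /asboolP h1 /asboolP h2; apply/asboolP => x.
  exact: le_trans (h2 x) (h1 x).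
- move=> [q1 p1] [q2 p2] /asboolP /= h1 /asboolP /= h2.
  suff q12 : q1 = q2 by subst q2; congr exist; exact: Prop_irrelevance.
  by apply/funext => x; apply/eqP; rewrite eq_le h1 h2.
(* A nonempty chain is bounded by its pointwise infimum; the empty one gets [directional p y]
   itself. *)
- have [/set0P[q0 Aq0]|/negP/negPn/eqP A0] := pselect (A != set0); last first.
    exists (exist _ (directional p y) (conj sp' (fun x => lexx _))) => q.
    by rewrite A0.
  pose g (k : {k : T | A k}) : V -> R := sval (sval k).
  have gs k : sublinear (g k) := proj1 (svalP (sval k)).
  have gle k x : g k x <= directional p y x := proj2 (svalP (sval k)) x.
  have glow k x : - directional p y (- x) <= g k x.
    by apply: le_trans (sublinear_lower _ (gs k)); rewrite lerN2 gle.
  have gtot k1 k2 : exists k, forall x, g k x <= g k1 x /\ g k x <= g k2 x.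
    have [/asboolP h|/asboolP h] := tA _ _ (svalP k1) (svalP k2).
      by exists k2 => x; split=> //; apply: h.
    by exists k1 => x; split=> //; apply: h.
  have ginf k x : inf (range (g^~ x)) <= g k x.
    apply: ge_inf; last by exists k.
    by exists (- directional p y (- x)) => _ [u _ <-].
  have sg : sublinear (fun x => inf (range (g^~ x))).
    apply: inf_sublinear glow _ _.
    + by exists (exist _ q0 Aq0); rewrite sublinear0.
    + move=> k1 k2 x z; have [k hq] := gtot k1 k2; exists k.
      apply: le_trans (proj1 (gs k) x z) _.
      by have := hq x; have := hq z; lra.
    + by move=> k r x r0; exists k; rewrite (proj2 (gs k)) // ltW.
  have inf_le x : inf (range (g^~ x)) <= directional p y x.
    exact: le_trans (ginf (exist _ q0 Aq0) x) (gle _ _).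
  exists (exist _ (fun x => inf (range (g^~ x))) (conj sg inf_le)) => k Aq.
  apply/asboolP => x /=.
  exact: (ginf (exist _ k Aq)).
case: m mmin => f [sf fle] fmin.
have [fD fZ] : (forall x z, f (x + z) = f x + f z) /\
    (forall r x, f (r%:C *: x) = r * f x).
  apply: minimal_sublinear_linear => // q sq qf.
  have qle x : q x <= directional p y x by apply: le_trans (qf x) (fle x).
  suff /(congr1 sval) : exist _ q (conj sq qle) = exist _ f (conj sf fle) :> T.
    by [].
  by apply: fmin; apply/asboolP.
have dle x : directional p y x <= p x.
  have := @directional_le p y 0 x sp (lexx 0).
  by rewrite scale0r addr0 mul0r subr0.
exists f; split=> // [x|]; first exact: le_trans (fle x) (dle x).
apply/eqP; rewrite eq_le (le_trans (fle y) (dle y)) /=.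
have := @directional_le p y 1 (- y) sp ler01.
rewrite scale1r addNr mul1r sublinear0 // => dl.
have := fD y (- y); rewrite subrr (sublinear0 sf).
by have := fle (- y); lra.
Qed.

End HahnBanach.

Section States.
Context (R : realType) (B : cstarType R).

Definition state (om : {linear B -> R[i] | *%R}) :=
  om 1 = 1 /\ forall x, 0 <= om (star x * x).

(** A real functional [f] below the norm with [f 1 = 1] is nonnegative on the cone, since
    [t - f a <= cnorm (sc B t - a) <= t]. It remains to make it complex linear. *)
Lemma state_exists : exists om, state om.
Proof.
have sn : sublinear (@cnorm R B).
  split; first exact: ler_cnormD.
  by move=> r x r0; rewrite cnorm_scale ger0_norm.
have [f [fD fZ fle f1]] := hahn_banach 1 sn.
rewrite cnorm1 in f1.
have oppE (x : B) : - x = (- 1)%:C *: x by rewrite rmorphN rmorph1 scaleN1r.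
have fN x : f (- x) = - f x by rewrite oppE fZ mulN1r.
have fpos a : pos a -> 0 <= f a.
  move=> [_ [t ht]]; have := fle (sc B t - a).
  by rewrite fD fN /sc fZ f1 mulr1; lra.
have fsc t : f (sc B t) = t by rewrite /sc fZ f1 mulr1.
have fherm x : f (2^-1%:C *: (x + star x)) = 2^-1 * (f x + f (star x)).
  by rewrite fZ fD.
(* Symmetrising makes [re] vanish on ['i] times hermitian elements, so that [g] agrees with [f] on
   hermitian ones. *)
pose re x := 2^-1 * (f x + f (star x)).
pose g (x : B) : R[i] := re x +i* re (- 'i *: x).
have reD x y : re (x + y) = re x + re y by rewrite /re starD !fD; lra.
have reZ r x : re (r%:C *: x) = r * re x.
  by rewrite /re star_scale !fZ; ring.
have reN x : re (- x) = - re x by rewrite oppE reZ mulN1r.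
have gD x y : g (x + y) = g x + g y by rewrite /g scalerDr !reD.
have gR r x : g (r%:C *: x) = r%:C * g x.
  rewrite /g scalerA (mulrC (- 'i)) -scalerA !reZ.
  by apply/eqP; rewrite eq_complex /= !mul0r subr0 addr0 !eqxx.
have ii : 'i * 'i = - 1 :> R[i] by rewrite -expr2 sqrCi.
have gi x : g ('i *: x) = 'i * g x.
  rewrite /g scalerA mulNr ii opprK scale1r scaleNr reN -complexiE.
  by apply/eqP; rewrite eq_complex /= !mul0r !mul1r sub0r add0r opprK !eqxx.
have gZ a x : g (a *: x) = a * g x.
  by rewrite [a]complexE complexiE scalerDl -scalerA gD gi !gR mulrA -mulrDl.
have gL : linear_for *%R g by move=> a x y; rewrite gD gZ.
pose gm := GRing.isLinear.Build R[i] B R[i] *%R g gL.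
pose om : {linear B -> R[i] | *%R} := HB.pack g gm.
have gh y : herm y -> g y = (f y)%:C.
  move=> hy; have -> : g y = re y +i* re (- 'i *: y) by [].
  rewrite /re hy starZ hy rmorphN /= conjCi opprK scaleNr fN addNr mulr0.
  by have -> : 2^-1 * (f y + f y) = f y by lra.
exists om; split=> [|x]; rewrite /om /=.
  by rewrite gh ?f1 //; exact: herm1.
rewrite gh ?ler0c; last by rewrite /herm starM starK.
by apply: fpos; exact: pos_starM.
Qed.

End States.

(** * Matrices as a C*-algebra; completely positive maps *)

Lemma real_cauchy_cvg (R : realType) (v : nat -> R) :
  (forall e, 0 < e -> exists n0, forall m n, (n0 <= m)%N -> (n0 <= n)%N ->
    `|v m - v n| < e) -> exists l : R, v @ \oo --> l.
Proof.
move=> h; suff : cvgn v by exists (limn v).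
apply/cauchy_cvgP/cauchy_exP => e /h [n0 hn].
by exists (v n0), n0 => // n /= n0n; apply: hn.
Qed.

Lemma cvg_sum0 (R : realType) (I : Type) (r : seq I) (f : I -> nat -> R) :
  (forall i, f i @ \oo --> (0 : R)) ->
  (fun n => \sum_(i <- r) f i n) @ \oo --> (0 : R).
Proof.
move=> f0; elim: r => [|i r IH].
  by under eq_fun do rewrite big_nil; exact: cvg_cst.
under eq_fun do rewrite big_cons.
by have h := cvgD (f0 i) IH; rewrite addr0 in h; exact: h.
Qed.

Lemma normc_ge_Re (R : rcfType) (z : R[i]) : `|complex.Re z| <= normc z.
Proof.
by rewrite -lecR; exact: normc_ge_Re.
Qed.

Lemma normc_ge_Im (R : rcfType) (z : R[i]) : `|complex.Im z| <= normc z.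
Proof.
by case: z => a b /=; rewrite -sqrtr_sqr ler_wsqrtr // lerDr sqr_ge0.
Qed.

Lemma normc_le_ReIm (R : rcfType) (z : R[i]) :
  normc z <= `|complex.Re z| + `|complex.Im z|.
Proof.
case: z => a b /=; have h : 0 <= `|a| + `|b| by rewrite addr_ge0.
rewrite -[leRHS](ger0_norm h) -(sqrtr_sqr (_ + _)) ler_wsqrtr // sqrrD.
rewrite !real_normK ?num_real //.
by rewrite -addrA lerD2l lerDr mulrn_wge0 // mulr_ge0.
Qed.

Lemma normc_ge0 (R : rcfType) (z : R[i]) : 0 <= normc z.
Proof. by rewrite -ler0c; exact: (@normr_ge0 _ R[i]). Qed.

Section RowNorm.
Context (R : realType) (n : nat).
Local Notation K := R[i].
Implicit Types (v w : 'rV[K]_n) (X Y : 'M[K]_n).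

Definition rnorm v : R := complex.Re (sqrtC (dotmx v v)).

Lemma rnormC v : (rnorm v)%:C = sqrtC (dotmx v v).
Proof. by rewrite RRe_real // ger0_real // sqrtC_ge0 dnorm_ge0. Qed.

Lemma rnorm_ge0 v : 0 <= rnorm v.
Proof. by rewrite -lecR rnormC sqrtC_ge0 dnorm_ge0. Qed.

Lemma rnorm_sqr v : (rnorm v ^+ 2)%:C = dotmx v v.
Proof. by rewrite rmorphXn /= rnormC sqrtCK. Qed.

Lemma rnormD v w : rnorm (v + w) <= rnorm v + rnorm w.
Proof. by rewrite -lecR rmorphD /= !rnormC; exact: triangle_lerif. Qed.

Lemma rnorm0 : rnorm 0 = 0.
Proof. by rewrite /rnorm linear0l sqrtC0. Qed.

Lemma rnorm0_eq0 v : rnorm v = 0 -> v = 0.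
Proof.
move=> v0; apply/eqP; rewrite -(dnorm_eq0 (@dotmx K n)); apply/eqP.
by apply: etrans (esym (rnorm_sqr v)) _; rewrite v0 expr0n rmorph0.
Qed.

Lemma rnorm_sum I (r : seq I) (F : I -> 'rV[K]_n) :
  rnorm (\sum_(i <- r) F i) <= \sum_(i <- r) rnorm (F i).
Proof.
elim/big_ind2: _ => [|x1 x2 y1 y2 h1 h2|//]; first by rewrite rnorm0.
by apply: le_trans (rnormD _ _) _; rewrite lerD.
Qed.

Lemma rnormZ a v : rnorm (a *: v) = normc a * rnorm v.
Proof.
apply/complexI; rewrite rmorphM /= !rnormC dnormZ sqrtCM ?nnegrE ?dnorm_ge0 //.
  by rewrite sqrCK.
Qed.

Lemma normc_dot_le v w : normc (dotmx v w) <= rnorm v * rnorm w.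
Proof. by rewrite -lecR rmorphM /= !rnormC; exact: CauchySchwarz_sqrt. Qed.

Lemma dotmx_mul v w X : dotmx (v *m X) w = dotmx v (w *m X ^t*).
Proof. by rewrite !dotmxE trmx_mul map_mxM /= trmxCK mulmxA. Qed.

Lemma normc_entry v j : normc (v 0 j) <= rnorm v.
Proof.
have d1 : dotmx (delta_mx 0 j) (delta_mx 0 j) = 1 :> K.
  rewrite dotmxE mxE (bigD1 j) //= big1 ?addr0 => [|k kj].
    by rewrite !mxE !eqxx conjC1 mulr1.
  by rewrite !mxE (negPf kj) andbF mul0r.
have <- : dotmx v (delta_mx 0 j) = v 0 j.
  rewrite dotmxE mxE (bigD1 j) //= big1 ?addr0 => [|k kj].
    by rewrite !mxE !eqxx conjC1 mulr1.
  by rewrite !mxE (negPf kj) andbF conjC0 mulr0.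
apply: le_trans (normc_dot_le _ _) _.
by rewrite /rnorm d1 sqrtC1 mulr1.
Qed.

Fact opnorm_key : unit. Proof. exact: tt. Qed.

(* Locked, since comparing two operator norms by computation diverges. *)
Definition opnorm X : R :=
  locked_with opnorm_key (sup [set rnorm (v *m X) | v in [set v | rnorm v <= 1]]).

Lemma rnorm_mulmx_bound v X :
  rnorm (v *m X) <= rnorm v * \sum_i rnorm (row i X).
Proof.
rewrite mulmx_sum_row; apply: le_trans (rnorm_sum _ _) _.
rewrite mulr_sumr; apply: ler_sum => i _.
by rewrite rnormZ ler_wpM2r ?rnorm_ge0 // normc_entry.
Qed.

Lemma opnorm_has_sup X :
  has_sup [set rnorm (v *m X) | v in [set v | rnorm v <= 1]].
Proof.
split; first by exists (rnorm (0 *m X)), 0 => //=; rewrite rnorm0.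
exists (\sum_i rnorm (row i X)) => _ [v /= v1 <-].
apply: le_trans (rnorm_mulmx_bound _ _) _.
by rewrite ler_piMl // sumr_ge0 // => i _; apply: rnorm_ge0.
Qed.

Lemma rnorm_mulmx v X : rnorm (v *m X) <= opnorm X * rnorm v.
Proof.
have [v0|vn0] := eqVneq (rnorm v) 0.
  by rewrite (rnorm0_eq0 v0) mul0mx rnorm0 mulr0.
have vp : 0 < rnorm v by rewrite lt_neqAle eq_sym vn0 rnorm_ge0.
rewrite -ler_pdivrMr // mulrC.
have -> : (rnorm v)^-1 * rnorm (v *m X) =
    rnorm (((rnorm v)^-1%:C *: v) *m X).
  by rewrite -scalemxAl rnormZ normcR ger0_norm // invr_ge0 ltW.
rewrite [opnorm X]unlock; apply: sup_upper_bound; first exact: opnorm_has_sup.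
exists ((rnorm v)^-1%:C *: v) => //=.
by rewrite rnormZ normcR ger0_norm ?invr_ge0 ?rnorm_ge0 // mulVf.
Qed.

Lemma opnorm_le X r : 0 <= r ->
  (forall v, rnorm (v *m X) <= r * rnorm v) -> opnorm X <= r.
Proof.
move=> r0 h; rewrite [opnorm X]unlock; apply: ge_sup.
  exact: (proj1 (opnorm_has_sup X)).
move=> _ [v /= v1 <-]; apply: le_trans (h v) _.
by rewrite ler_piMr.
Qed.

Lemma opnorm_ge0 X : 0 <= opnorm X.
Proof.
have := @sup_upper_bound _ _ (opnorm_has_sup X) (rnorm (0 *m X)) _.
rewrite mul0mx rnorm0 [opnorm X]unlock; apply.
by exists 0; rewrite /= ?mul0mx rnorm0.
Qed.

Lemma opnorm_entry X i j : normc (X i j) <= opnorm X.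
Proof.
have d1 : rnorm (delta_mx 0 i) = 1.
  rewrite /rnorm dotmxE mxE (bigD1 i) //= big1 ?addr0 => [|k ki].
    by rewrite !mxE !eqxx conjC1 mulr1 sqrtC1.
  by rewrite !mxE (negPf ki) andbF mul0r.
rewrite -[X i j](_ : (row i X) 0 j = _); last by rewrite mxE.
apply: le_trans (normc_entry _ _) _; rewrite rowE.
by apply: le_trans (rnorm_mulmx _ _) _; rewrite d1 mulr1.
Qed.

Lemma opnorm_le_sum X : opnorm X <= \sum_i \sum_j normc (X i j).
Proof.
have nc0 := @normc_ge0 R.
have s0 : 0 <= \sum_i \sum_j normc (X i j).
  by apply: sumr_ge0 => i _; apply: sumr_ge0.
apply: opnorm_le => // v; apply: le_trans (rnorm_mulmx_bound _ _) _.
rewrite mulrC ler_wpM2r ?rnorm_ge0 //; apply: ler_sum => i _.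
rewrite [row i X]row_sum_delta; apply: le_trans (rnorm_sum _ _) _.
apply: ler_sum => j _; rewrite rnormZ mxE ler_piMr //.
rewrite /rnorm dotmxE mxE (bigD1 j) //= big1 ?addr0 => [|k kj].
  by rewrite !mxE !eqxx conjC1 mulr1 sqrtC1.
by rewrite !mxE (negPf kj) andbF mul0r.
Qed.

Lemma opnorm0_eq0 X : opnorm X = 0 -> X = 0.
Proof.
move=> X0; apply/matrixP => i j; rewrite mxE; apply: eq0_normc.
by apply/eqP; rewrite eq_le normc_ge0 -X0 opnorm_entry.
Qed.

Lemma opnormD X Y : opnorm (X + Y) <= opnorm X + opnorm Y.
Proof.
apply: opnorm_le => [|v]; first by rewrite addr_ge0 // opnorm_ge0.
rewrite mulmxDr mulrDl; apply: le_trans (rnormD _ _) _.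
by rewrite lerD // rnorm_mulmx.
Qed.

Lemma opnormZ a X : opnorm (a *: X) = normc a * opnorm X.
Proof.
have nc0 := @normc_ge0 R.
have le b Y : opnorm (b *: Y) <= normc b * opnorm Y.
  apply: opnorm_le => [|v]; first by rewrite mulr_ge0 // opnorm_ge0.
  by rewrite -scalemxAr rnormZ -mulrA ler_wpM2l // rnorm_mulmx.
apply/eqP; rewrite eq_le le /=; have [->|an0] := eqVneq a 0.
  by rewrite normc0 mul0r opnorm_ge0.
have np : 0 < normc a.
  by rewrite lt_neqAle nc0 andbT eq_sym; apply: contra an0 => /eqP/eq0_normc ->.
rewrite -ler_pdivlMl // -normcV -{1}[X](scalerK an0).
exact: le.
Qed.

Lemma opnormM X Y : opnorm (X *m Y) <= opnorm X * opnorm Y.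
Proof.
apply: opnorm_le => [|v]; first by rewrite mulr_ge0 // opnorm_ge0.
rewrite mulmxA; apply: le_trans (rnorm_mulmx _ _) _.
have := opnorm_ge0 Y; have := rnorm_mulmx v X.
move: (opnorm X) (opnorm Y) (rnorm v) (rnorm (v *m X)) => a b c d.
by move=> dac b0; rewrite (mulrC a) -mulrA; apply: ler_wpM2l.
Qed.

(** Matrices act on rows from the right, so Cauchy-Schwarz naturally bounds the norm of [Y] by that
    of [Y *m Y ^t*]. This implies that [Y] and its adjoint have equal norms, and then the factors
    may be exchanged. *)
Lemma opnorm_star X : opnorm (X ^t* *m X) = opnorm X ^+ 2.
Proof.
have le1 Y : opnorm Y ^+ 2 <= opnorm (Y *m Y ^t*).
  rewrite -[leRHS]sqr_sqrtr ?opnorm_ge0 //.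
  rewrite ler_pXn2r ?nnegrE ?opnorm_ge0 ?sqrtr_ge0 //.
  apply: opnorm_le => // v.
  rewrite -(@ler_pXn2r _ 2) ?nnegrE ?mulr_ge0 ?rnorm_ge0 ?sqrtr_ge0 //.
  rewrite exprMn sqr_sqrtr ?opnorm_ge0 //.
  have -> : rnorm (v *m Y) ^+ 2 = normc (dotmx v (v *m (Y *m Y ^t*))).
    rewrite mulmxA -dotmx_mul -rnorm_sqr normcR ger0_norm //.
    by rewrite sqr_ge0.
  apply: le_trans (normc_dot_le _ _) _.
  by rewrite mulrC expr2 mulrA ler_wpM2r ?rnorm_ge0 // rnorm_mulmx.
have le2 Y : opnorm Y <= opnorm (Y ^t*).
  have [->|n0] := eqVneq (opnorm Y) 0; first exact: opnorm_ge0.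
  have yp : 0 < opnorm Y by rewrite lt_neqAle eq_sym n0 opnorm_ge0.
  have := le_trans (le1 Y) (opnormM Y (Y ^t*)).
  by move: (opnorm (Y ^t*)) => b; rewrite expr2 ler_pM2l.
have eq1 Y : opnorm (Y ^t*) = opnorm Y.
  have := le2 (Y ^t*); have := le2 Y; rewrite trmxCK.
  by move: (opnorm (Y ^t*)) => b h1 h2; apply: le_anti; rewrite h1 h2.
apply/eqP; rewrite eq_le; apply/andP; split.
  by have := opnormM (X ^t*) X; rewrite eq1 expr2.
by have := le1 (X ^t*); rewrite eq1 trmxCK.
Qed.

(** The norm dominates every entry and is dominated by the sum of their moduli, so limits are taken
    entrywise. *)
Lemma opnorm_complete (V : nat -> 'M[K]_n) :
  (forall e : R, 0 < e -> exists n0 : nat, forall p q : nat,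
     (n0 <= p)%N -> (n0 <= q)%N -> opnorm (V p - V q) < e) ->
  exists L, (fun p => opnorm (V p - L)) @ \oo --> (0 : R).
Proof.
move=> cV.
have /choice [a ha] (ij : 'I_n * 'I_n) :
    exists l : R, (fun p => complex.Re (V p ij.1 ij.2)) @ \oo --> l.
  apply: real_cauchy_cvg => e /cV [n0 hn]; exists n0 => p q hp hq.
  apply: le_lt_trans (hn _ _ hp hq); rewrite -raddfB /=.
  apply: le_trans (normc_ge_Re _) _; apply: le_trans (opnorm_entry _ ij.1 ij.2).
  by rewrite !mxE.
have /choice [b hb] (ij : 'I_n * 'I_n) :
    exists l : R, (fun p => complex.Im (V p ij.1 ij.2)) @ \oo --> l.
  apply: real_cauchy_cvg => e /cV [n0 hn]; exists n0 => p q hp hq.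
  apply: le_lt_trans (hn _ _ hp hq); rewrite -raddfB /=.
  apply: le_trans (normc_ge_Im _) _; apply: le_trans (opnorm_entry _ ij.1 ij.2).
  by rewrite !mxE.
exists (\matrix_(i, j) (a (i, j) +i* b (i, j))).
pose g p := \sum_i \sum_j (`|complex.Re (V p i j) - a (i, j)| +
  `|complex.Im (V p i j) - b (i, j)|).
apply: (@squeeze_cvgr _ _ _ _ (fun=> 0) g); last 2 first.
- exact: cvg_cst.
- apply: cvg_sum0 => i; apply: cvg_sum0 => j.
  have h (f : nat -> R) l : f @ \oo --> l ->
      (fun p => `|f p - l|) @ \oo --> (0 : R).
    move=> fl; have := cvg_norm (cvgB fl (cvg_cst l)).
    by rewrite subrr normr0; exact.
  have h2 := cvgD (h _ _ (ha (i, j))) (h _ _ (hb (i, j))).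
  by rewrite addr0 in h2; exact: h2.
apply: nearW => p; rewrite opnorm_ge0 /=.
apply: le_trans (opnorm_le_sum _) _; apply: ler_sum => i _; apply: ler_sum => j _.
apply: le_trans (normc_le_ReIm _) _; rewrite !mxE.
by case: (V p i j).
Qed.

End RowNorm.

Section MatrixCStar.
Context (R : realType) (n : nat).
Local Notation K := R[i].

Fact trmxC_involutive : involutive (fun X : 'M[K]_n.+1 => X ^t*).
Proof. by move=> X; rewrite trmxCK. Qed.

Fact trmxCD : {morph (fun X : 'M[K]_n.+1 => X ^t*) : X Y / X + Y}.
Proof. by move=> X Y; rewrite linearD /= map_mxD. Qed.

Fact trmxCZ (a : K) (X : 'M[K]_n.+1) : (a *: X) ^t* = a^* *: X ^t*.
Proof. by rewrite linearZ /= map_mxZ. Qed.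

Fact trmxCM (X Y : 'M[K]_n.+1) : (X * Y) ^t* = Y ^t* * X ^t*.
Proof. by rewrite trmx_mul map_mxM. Qed.

HB.instance Definition _ := @isCStar.Build R 'M[K]_n.+1
  (@opnorm R n.+1) (fun X => X ^t*) (@opnorm0_eq0 R n.+1) (@opnormD R n.+1)
  (@opnormZ R n.+1) (@opnorm_complete R n.+1) (@opnormM R n.+1)
  trmxC_involutive trmxCD trmxCZ trmxCM (@opnorm_star R n.+1).

End MatrixCStar.

(** Diagonalize [G] by a unitary [P]: the eigenvalues are nonnegative, and their roots times the
    rows of [P] form [Y]. A general finite index type allows indexing by pairs later. *)
Lemma psd_factor (K : numClosedFieldType) (I : finType) (G : I -> I -> K) :
  (forall i j, G j i = (G i j)^*) ->
  (forall xi : I -> K, 0 <= \sum_i \sum_j (xi i)^* * G i j * xi j) ->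
  exists Y : I -> I -> K, forall i j, G i j = \sum_k (Y k i)^* * Y k j.
Proof.
move=> Gh Gp; pose M : 'M[K]_#|I| := \matrix_(i, j) G (enum_val i) (enum_val j).
have Mh : M \is hermsymmx.
  apply/is_hermitianmxP; rewrite expr0 scale1r; apply/matrixP => i j.
  by rewrite !mxE.
have /orthomx_spectralP := hermitian_normalmx Mh.
set P := spectralmx M; set d := spectral_diag M => ME.
have Pu : P \is unitarymx := spectral_unitarymx M.
have Pd : P *m M *m P ^t* = diag_mx d.
  rewrite {1}ME invmx_unitary // !mulmxA mulmxtVK // (unitarymxP Pu) mul1mx.
  by [].
have d0 k : 0 <= d 0 k.
  have /matrixP/(_ k k) := Pd; rewrite [RHS]mxE eqxx mulr1n => <-.
  (* On the conjugated [k]-th row of [P] the form takes the [k]-th eigenvalue as its value. *)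
  have := Gp (fun i => (P k (enum_rank i))^*).
  rewrite (eq_bigr (fun i => \sum_j P k (enum_rank i) *
    M (enum_rank i) (enum_rank j) * (P k (enum_rank j))^*)); last first.
    by move=> i _; apply: eq_bigr => j _; rewrite conjCK mxE !enum_rankK.
  rewrite (reindex (@enum_val I predT)) /=; last exact/onW_bij/enum_val_bij.
  move/le_trans; apply; rewrite le_eqVlt; apply/orP; left; apply/eqP.
  rewrite mxE exchange_big /=.
  rewrite (reindex (@enum_val I predT)) /=; last exact/onW_bij/enum_val_bij.
  apply: eq_bigr => j _; rewrite !mxE mulr_suml; apply: eq_bigr => i _.
  by rewrite !enum_valK !mxE.
exists (fun k i => sqrtC (d 0 (enum_rank k)) * P (enum_rank k) (enum_rank i)).
move=> i j; have /matrixP/(_ (enum_rank i) (enum_rank j)) := ME.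
rewrite [LHS]mxE !enum_rankK => ->; rewrite invmx_unitary // mxE.
rewrite (reindex (@enum_rank I)) /=; last exact/onW_bij/enum_rank_bij.
apply: eq_bigr => k _; rewrite mul_mx_diag !mxE rmorphM /=.
have -> : (sqrtC (d 0 (enum_rank k)))^* = sqrtC (d 0 (enum_rank k)).
  by apply: geC0_conj; rewrite sqrtC_ge0.
rewrite [RHS]mulrACA -expr2 sqrtCK.
by rewrite mulrA; congr (_ * _); rewrite mulrC.
Qed.

(** * Unital completely positive maps into and out of matrix algebras *)

Section StateTheory.
Context (R : realType) (B : cstarType R) (om : {linear B -> R[i] | *%R}).
Hypothesis som : state om.

(** Polarization: [om] is real on the star square of [1 + c *: x]. The cases [c = 1] and [c = 'i]
    make both [om x + om (star x)] and ['i] times their difference real. *)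
Lemma state_herm x : om (star x) = (om x)^*.
Proof.
have omr y : om (star y * y) \is Num.real by rewrite ger0_real // (proj2 som).
have key c : c * om x + c^* * om (star x) \is Num.real.
  have : om (star (1 + c *: x) * (1 + c *: x)) - 1 - c^* * c * om (star x * x)
      \is Num.real.
    rewrite rpredB ?rpredB ?rpred1 // rpredM // mulrC.
    by rewrite ger0_real // mul_conjC_ge0.
  have -> : om (star (1 + c *: x) * (1 + c *: x)) =
      1 + c * om x + (c^* * om (star x) + c^* * (c * om (star x * x))).
    rewrite starD star1 starZ mulrDl !mulrDr mulr1 !mul1r.
    rewrite -!scalerAl -!scalerAr mulr1 !linearD !linearZ /= (proj1 som).
    reflexivity.
  move: (om x) (om (star x)) (om (star x * x)) (c^*) => a b d c'.
  by congr (_ \is _); ring.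
have h1 := key 1; rewrite conjC1 !mul1r in h1.
have h2 := key 'i; rewrite conjCi in h2.
move/CrealP: h1; move/CrealP: h2; rewrite !rmorphD !rmorphM rmorphN /= conjCi.
rewrite opprK; move: (om x) (om (star x)) => a b h2 h1.
have ii : 'i * 'i = - 1 :> R[i] by rewrite -expr2 sqrCi.
have : 2%:R * (b - a^*) = (a + b - (a^* + b^*)) +
   'i * ('i * a + - 'i * b - (- 'i * a^* + 'i * b^*)).
  by rewrite !mulrDr !mulrN !mulrDr !mulrA !mulrN !mulNr ii; ring.
rewrite h1 h2 !subrr mulr0 addr0 => /eqP.
by rewrite mulf_eq0 pnatr_eq0 /= subr_eq0 => /eqP.
Qed.

Section Compression.
Context (r : nat) (Z : 'I_r.+1 -> B).
Hypothesis Zo : forall i j, om (star (Z i) * Z j) = (i == j)%:R.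

(** The GNS representation of [om], compressed to the vectors of the [Z i], which are orthonormal
    there by [Zo]. *)
Definition compression (x : B) : 'M[R[i]]_r.+1 :=
  \matrix_(i, j) om (star (Z i) * x * Z j).

Fact compression_is_linear : linear compression.
Proof.
move=> a x y; apply/matrixP => i j; rewrite !mxE mulrDr mulrDl linearD /=.
by rewrite -scalerAr -scalerAl linearZ.
Qed.

HB.instance Definition _ := GRing.isLinear.Build R[i] B 'M[R[i]]_r.+1 *:%R
  compression compression_is_linear.

(** With outer and inner indices paired, the image of a star square is a scalar matrix whose
    quadratic form is a sum of values [om (star (W c) * W c)]. [psd_factor] then supplies a root,
    which is cut back into blocks. *)
Lemma compression_ucp : ucp compression.
Proof.
split; last first.
  by apply/matrixP => i j; rewrite !mxE mulr1 Zo.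
move=> n X [Y XE].
pose G (p q : 'I_n * 'I_r.+1) := compression (X p.1 q.1) p.2 q.2.
have GE p q : G p q = \sum_c om (star (Y c p.1 * Z p.2) * (Y c q.1 * Z q.2)).
  rewrite /G mxE XE mxE mulr_sumr mulr_suml linear_sum; apply: eq_bigr => c _.
  by rewrite !mxE starM !mulrA.
have [|xi|y yE] := @psd_factor R[i] _ G.
- move=> p q; rewrite !GE rmorph_sum; apply: eq_bigr => c _ /=.
  rewrite -state_herm; congr (om _).
  by move: (Y c q.1 * _) (Y c p.1 * _) => a b; rewrite starM starK.
- pose W c := \sum_q xi q *: (Y c q.1 * Z q.2).
  have -> : \sum_p \sum_q (xi p)^* * G p q * xi q =
      \sum_c om (star (W c) * W c).
    rewrite (eq_bigr (fun p => \sum_c \sum_q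
      om (star (xi p *: (Y c p.1 * Z p.2)) * (xi q *: (Y c q.1 * Z q.2))))).
      rewrite exchange_big; apply: eq_bigr => c _ /=.
      rewrite raddf_sum mulr_suml linear_sum; apply: eq_bigr => p _ /=.
      by rewrite mulr_sumr linear_sum.
    move=> p _; rewrite exchange_big; apply: eq_bigr => q _ /=.
    rewrite GE mulr_sumr mulr_suml; apply: eq_bigr => c _.
    have omZ a x : om (a *: x) = a * om x by rewrite linearZ.
    have -> (a b : B) : star (xi p *: a) * (xi q *: b) =
        (xi p)^* *: (xi q *: (star a * b)).
      by rewrite starZ -scalerAr -scalerAl scalerA mulrC -scalerA.
    by rewrite !omZ -mulrA [in LHS](mulrC _ (xi q)).
  by apply: sumr_ge0 => c _; apply: (proj2 som).
- exists (\matrix_(c, a) \matrix_(k, i) y (c, k) (a, i)).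
  apply/matrixP => a b; rewrite !mxE; apply/matrixP => i j.
  rewrite -[LHS]/(G (a, i) (b, j)) yE summxE.
  rewrite (eq_bigr (fun p => (y (p.1, p.2) (a, i))^* * y (p.1, p.2) (b, j)));
    last by case.
  rewrite -(pair_bigA _ (fun c k => (y (c, k) (a, i))^* * y (c, k) (b, j))) /=.
  apply: eq_bigr => c _; rewrite !mxE; apply: eq_bigr => k _.
  by rewrite !mxE.
Qed.

End Compression.
End StateTheory.

Section Expansion.
Context (R : realType) (B : cstarType R) (r : nat) (s : 'I_r.+1 -> B).

Definition expansion (X : 'M[R[i]]_r.+1) : B :=
  \sum_i \sum_j X i j *: (s i * star (s j)).

Fact expansion_is_linear : linear expansion.
Proof.
move=> a X Y; rewrite scaler_sumr -big_split; apply: eq_bigr => i _.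
rewrite scaler_sumr -big_split; apply: eq_bigr => j _ /=.
by rewrite !mxE scalerDl scalerA.
Qed.

HB.instance Definition _ := GRing.isLinear.Build R[i] 'M[R[i]]_r.+1 B *:%R
  expansion expansion_is_linear.

(* Isometries with orthogonal ranges turn a sum of squares into a square. *)
Lemma expansion_ucp (V : 'I_r.+1 -> B) :
  (forall k l, star (V k) * V l = (k == l)%:R) ->
  \sum_i s i * star (s i) = 1 -> ucp expansion.
Proof.
move=> Vo s1; split; last first.
  rewrite -s1 /expansion; apply: eq_bigr => i _.
  rewrite (bigD1 i) //= mxE eqxx scale1r big1 ?addr0 // => j ji.
  by rewrite mxE eq_sym (negPf ji) scale0r.
move=> n X [Y ->].
pose b c k a := \sum_j Y c a k j *: star (s j).
exists (\matrix_(c, a) \sum_k V k * b c k a).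
apply/matrixP => a a'; rewrite !mxE /expansion.
transitivity (\sum_c \sum_k star (b c k a) * b c k a').
  transitivity (\sum_i \sum_j \sum_c \sum_k
    ((Y c a k i)^* * Y c a' k j) *: (s i * star (s j))).
    apply: eq_bigr => i _; apply: eq_bigr => j _.
    rewrite summxE scaler_suml; apply: eq_bigr => c _.
    rewrite !mxE scaler_suml; apply: eq_bigr => k _.
    by rewrite !mxE.
  under eq_bigr do rewrite exchange_big.
  rewrite exchange_big; apply: eq_bigr => c _ /=.
  under eq_bigr do rewrite exchange_big.
  rewrite exchange_big; apply: eq_bigr => k _ /=.
  rewrite raddf_sum mulr_suml; apply: eq_bigr => i _ /=.
  rewrite mulr_sumr; apply: eq_bigr => j _.
  by rewrite starZ starK -scalerAl -scalerAr scalerA.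
clearbody b; apply: eq_bigr => c _; rewrite !mxE.
rewrite raddf_sum mulr_suml; apply: eq_bigr => k _ /=.
rewrite mulr_sumr (bigD1 k) //= big1 => [|l lk].
  by rewrite addr0 starM -mulrA (mulrA (star (V k))) Vo eqxx mul1r.
by rewrite starM -mulrA (mulrA (star (V k))) Vo eq_sym (negPf lk) mul0r mulr0.
Qed.

End Expansion.

(** * Words in the Cuntz-Krieger generators *)

Section CuntzKrieger.
Context (R : realType) (B : cstarType R) (N : nat) (A : 'M[nat]_N).
Variable (S : 'I_N -> B).
Hypotheses (hA01 : zero_one A) (hA : primitive_mx A) (hS : ck_relations A S).
Implicit Types (i j k a b : 'I_N) (u v w : seq 'I_N) (x y : B).

Definition rproj j := S j * star (S j).
Definition sproj i := \sum_j rproj j *+ A i j.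

Lemma starSS i k : star (S i) * S k = if i == k then sproj i else 0.
Proof. by rewrite (proj2 hS); case: eqP; rewrite ?mulr1n ?mulr0n. Qed.

Lemma sum_rproj : \sum_j rproj j = 1. Proof. exact: (proj1 hS). Qed.

Lemma star_rproj j : star (rproj j) = rproj j.
Proof. by rewrite /rproj starM starK. Qed.

Lemma star_sproj i : star (sproj i) = sproj i.
Proof.
rewrite /sproj raddf_sum; apply: eq_bigr => j _ /=.
by rewrite raddfMn /= star_rproj.
Qed.

(** That [S k] is a partial isometry is not among the relations. It follows by multiplying
    [1 = \sum_j rproj j] by [S k], as every term with [j != k] vanishes. *)
Lemma rprojS j k : rproj j * S k = if j == k then S k else 0.
Proof.
have ne i l : i != l -> rproj i * S l = 0.
  by move=> /negPf il; rewrite /rproj -mulrA starSS il mulr0.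
case: eqP => [->|/eqP]; last exact: ne.
rewrite -[RHS]mul1r -sum_rproj mulr_suml (bigD1 k) //= big1 ?addr0 // => i.
exact: ne.
Qed.

Lemma rproj_orth j k : rproj j * rproj k = if j == k then rproj j else 0.
Proof.
rewrite {2}/rproj mulrA rprojS; case: eqP => [->|] //.
by rewrite mul0r.
Qed.

Lemma sprojS i j : sproj i * S j = S j *+ A i j.
Proof.
rewrite /sproj mulr_suml (bigD1 j) //= big1 ?addr0 => [|k /negPf kj].
  by rewrite mulrnAl rprojS eqxx.
by rewrite mulrnAl rprojS kj mul0rn.
Qed.

Lemma sproj_rproj i j : (0 < A i j)%N -> sproj i * rproj j = rproj j.
Proof.
rewrite /rproj mulrA sprojS; case: (hA01 i j) => -> //.
Qed.

Lemma S_sproj i : S i * sproj i = S i.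
Proof. by have := rprojS i i; rewrite /rproj -mulrA starSS eqxx. Qed.

Lemma S_mul i j : S i * S j = (S i * S j) *+ A i j.
Proof. by rewrite -{1}S_sproj -mulrA sprojS mulrnAr. Qed.

Definition wordS w := foldr (fun i x => S i * x) 1 w.

Lemma wordS_cat u v : wordS (u ++ v) = wordS u * wordS v.
Proof. by elim: u => [|i u IH] /=; rewrite ?mul1r // IH mulrA. Qed.

Definition edge : rel 'I_N := fun i j => (0 < A i j)%N.
Definition admissible w := sorted edge w.

Lemma wordS_nadm w : ~~ admissible w -> wordS w = 0.
Proof.
case: w => // i w; elim: w i => //= j w IH i; rewrite negb_and => /orP[|h].
  by rewrite /edge lt0n negbK => /eqP A0; rewrite mulrA S_mul A0 mulr0n mul0r.
by rewrite -/(wordS (j :: w)) IH // mulr0.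
Qed.

Lemma sproj_wordS i w : w != [::] -> admissible (i :: w) ->
  sproj i * wordS w = wordS w.
Proof.
case: w => // j w _ /= /andP[eij _]; rewrite mulrA sprojS.
by move: eij; rewrite /edge; case: (hA01 i j) => ->.
Qed.

(** Each cancelled letter leaves its source projection, which the next letter of [w] absorbs; strict
    inequality of the sizes ensures that there is one. *)
Lemma star_wordS_take u w : admissible w -> (size u < size w)%N ->
  star (wordS u) * wordS w =
    if take (size u) w == u then wordS (drop (size u) w) else 0.
Proof.
elim: u w => [|i u IH] w aw.
  by rewrite take0 drop0 eqxx star1 mul1r.
case: w aw => // j w aw; rewrite ltnS => uw.
have wn : w != [::] by case: w uw {aw}.
rewrite /= starM -mulrA (mulrA (star (S i))) starSS eqseq_cons eq_sym.
case: eqP => [ij|_]; last by rewrite mul0r mulr0.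
rewrite ij in aw.
by rewrite (sproj_wordS wn aw) IH //; exact: path_sorted aw.
Qed.

(** At equal lengths nothing absorbs the source projection of the last letter, so it remains. *)
Lemma star_wordS_eqsize i j u v : admissible (i :: u) -> size u = size v ->
  star (wordS (i :: u)) * wordS (j :: v) =
    if i :: u == j :: v then sproj (last i u) else 0.
Proof.
elim: u v i j => [|k u IH] [|l v] i j //.
  rewrite /= !mulr1 starSS eqseq_cons eqxx andbT.
  by [].
move=> aiu [uv]; have au := path_sorted aiu.
have wordS_cons a w : wordS (a :: w) = S a * wordS w by [].
rewrite (wordS_cons i) (wordS_cons j) starM -mulrA (mulrA (star (S i))).
rewrite starSS eqseq_cons.
case: eqP => _; last by rewrite mul0r mulr0.
rewrite mulrA -[sproj i]star_sproj -starM sproj_wordS //.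
exact: IH.
Qed.

(** The gauge degree is tested on all star endomorphisms that rotate the generators, so no gauge
    action has to be chosen. Negative degrees are reached by taking adjoints. *)
Definition homog (d : nat) x := forall (z : R[i]) (f : {lrmorphism B -> B}),
  z * z^* = 1 -> star_preserving f -> (forall i, f (S i) = z *: S i) ->
  f x = z ^+ d *: x.

Lemma homog1 : homog 0 1.
Proof. by move=> z f _ _ _; rewrite rmorph1 expr0 scale1r. Qed.

Lemma homog0 d : homog d 0.
Proof. by move=> z f _ _ _; rewrite raddf0 scaler0. Qed.

Lemma homogM d e x y : homog d x -> homog e y -> homog (d + e) (x * y).
Proof.
move=> hx hy z f z1 sf fS; rewrite rmorphM /= (hx z) // (hy z) //.
by rewrite -scalerAl -scalerAr scalerA exprD.
Qed.

Lemma homogD d x y : homog d x -> homog d y -> homog d (x + y).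
Proof.
move=> hx hy z f z1 sf fS; rewrite raddfD /= (hx z) // (hy z) //.
by rewrite scalerDr.
Qed.

Lemma homog_sum d I (r : seq I) (F : I -> B) :
  (forall l : I, homog d (F l)) -> homog d (\sum_(i <- r) F i).
Proof.
by move=> h; elim/big_ind: _ => //; [exact: homog0|move=> *; exact: homogD].
Qed.

Lemma homogS i : homog 1 (S i).
Proof. by move=> z f _ _ fS; rewrite expr1. Qed.

Lemma homog_wordS w : homog (size w) (wordS w).
Proof.
elim: w => [|i w IH] /=; first exact: homog1.
by rewrite -add1n; apply: homogM => //; exact: homogS.
Qed.

Lemma homog_starM d e x y : homog d x -> homog (d + e) y ->
  homog e (star x * y).
Proof.
move=> hx hy z f z1 sf fS; rewrite rmorphM /= sf (hx z) // (hy z) //.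
rewrite starZ -scalerAl -scalerAr scalerA exprD mulrA rmorphXn /= -exprMn.
by rewrite (mulrC (z^*)) z1 expr1n mul1r.
Qed.

Lemma homog_rproj j : homog 0 (rproj j).
Proof.
move=> z f z1 sf fS; rewrite rmorphM /= sf fS starZ -scalerAl -scalerAr.
by rewrite scalerA z1 expr0.
Qed.

(** [V a i] is the product of the generators along the edges of one chosen path of length [n] from
    [a] to [i], times [rproj i]. Distinct end points give orthogonal ranges; where no path is chosen
    the value is 0. *)
Lemma path_isometries n : exists V : 'I_N -> 'I_N -> B,
  (forall a i, (0 < (A ^+ n) a i)%N ->
     [/\ homog n (V a i), star (V a i) * V a i = rproj i
       & rproj a * V a i = V a i]) /\
  (forall a b i j, i != j -> star (V a i) * V b j = 0).
Proof.
elim: n => [|n [V [V1 V2]]].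
  exists (fun a i => if a == i then rproj a else 0); split=> [a i|a b i j ij].
    rewrite expr0 mxE; case: eqP => // <- _.
    by split; rewrite ?star_rproj ?rproj_orth ?eqxx //; exact: homog_rproj.
  case: eqP => [->|_]; last by rewrite star0 mul0r.
  case: eqP => [->|_]; last by rewrite mulr0.
  by rewrite star_rproj rproj_orth (negPf ij).
pose nxt a i := [pick b | (0 < A a b)%N && (0 < (A ^+ n) b i)%N].
have sV a b i : (0 < A a b)%N -> (0 < (A ^+ n) b i)%N ->
    sproj a * V b i = V b i.
  by move=> ab /V1 [_ _ <-]; rewrite mulrA sproj_rproj.
exists (fun a i => if nxt a i is Some b then S a * V b i else 0).
split=> [a i|a b i j ij].
  rewrite exprS mxE => Asum; rewrite /nxt; case: pickP => [b /andP[ab bi]|no].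
    have [h1 h2 h3] := V1 _ _ bi; split.
    - by rewrite -add1n; apply: homogM => //; exact: homogS.
    - by rewrite starM -mulrA (mulrA (star (S a))) starSS eqxx sV.
    - by rewrite mulrA rprojS eqxx.
  move: Asum; rewrite big1 // => b _; have := no b.
  by case: (posnP (A a b)) => [->|_] /=; rewrite ?mul0r // lt0n
    => /negbFE/eqP ->; rewrite mulr0.
rewrite /nxt; case: pickP => [c /andP[ac ci]|_]; last by rewrite star0 mul0r.
case: pickP => [d /andP[bd dj]|_]; last by rewrite mulr0.
rewrite starM -mulrA (mulrA (star (S a))) starSS; case: eqP => [_|_].
  rewrite mulrA -[sproj a]star_sproj -starM sV //.
  exact: V2.
by rewrite mul0r mulr0.
Qed.

(** By primitivity every [i] is reached from every [a] in exactly [n] steps, so the initial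
    projections [rproj i] of the [V a i] add up to 1. *)
Lemma ck_isometries : exists n (T : 'I_N -> B), [/\ forall a, homog n (T a),
  forall a b, star (T a) * T b = (a == b)%:R & forall a, rproj a * T a = T a].
Proof.
have [n n0 An] := hA; have [V [V1 V2]] := path_isometries n.
exists n, (fun a => \sum_i V a i); split=> [a|a b|a].
- by apply: homog_sum => i; have [] := V1 _ _ (An a i).
- have rT c : rproj c * \sum_i V c i = \sum_i V c i.
    by rewrite mulr_sumr; apply: eq_bigr => i _; have [] := V1 _ _ (An c i).
  case: eqP => [<-|/eqP/negPf ab] /=; last first.
    rewrite -(rT a) -(rT b) starM star_rproj -mulrA (mulrA (rproj a)).
    by rewrite rproj_orth ab mul0r mulr0.
  rewrite raddf_sum mulr_suml -[RHS]sum_rproj; apply: eq_bigr => i _ /=.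
  rewrite mulr_sumr (bigD1 i) //= big1 ?addr0 => [|j ji].
    by have [] := V1 _ _ (An a i).
  by rewrite V2 // eq_sym.
- by rewrite mulr_sumr; apply: eq_bigr => i _; have [] := V1 _ _ (An a i).
Qed.

Lemma primitive_row j : exists a, (0 < A j a)%N.
Proof.
have [[|n] // n0 An] := hA; have := An j j; rewrite exprS mxE.
have [a Aa _|no] := pickP (fun a => 0 < A j a)%N; first by exists a.
by rewrite big1 // => a _; have := no a; case: (A j a) => // _; rewrite mul0r.
Qed.

(** Take for [U j] the isometry of a successor of [j]: its range lies under the source projection of
    [S j], so [S j * U j] is again an isometry. *)
Lemma sproj_isometries : exists n (U : 'I_N -> B), [/\ forall j, homog n (U j),
  forall j, star (U j) * U j = 1 & forall j, sproj j * U j = U j].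
Proof.
have [n [T [T1 T2 T3]]] := ck_isometries.
have /choice [c hc] := primitive_row.
exists n, (T \o c); split=> j //=; first by rewrite T2 eqxx.
by rewrite -T3 mulrA sproj_rproj.
Qed.

(** Two isometries with orthogonal ranges, available for [N >= 2], produce arbitrarily many as
    [T1 ^+ k * T0]. *)
Lemma orthogonal_isometries : (2 <= N)%N -> forall r, exists V : 'I_r -> B,
  forall k l : 'I_r, star (V k) * V l = (k == l)%:R.
Proof.
move=> N2 r; have [n [T [_ T2 _]]] := ck_isometries.
pose T0 := T (Ordinal (ltnW N2)); pose T1 := T (Ordinal N2).
have T00 : star T0 * T0 = 1 by rewrite T2.
have T11 : star T1 * T1 = 1 by rewrite T2.
have T01 : star T0 * T1 = 0 by rewrite T2.
have T10 : star T1 * T0 = 0 by rewrite T2.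
exists (fun k : 'I_r => T1 ^+ k * T0) => k l.
have key (m p : nat) : star (T1 ^+ m * T0) * (T1 ^+ p * T0) = (m == p)%:R.
  elim: m p => [|m IH] [|p].
  - by rewrite !expr0 !mul1r T00.
  - by rewrite expr0 mul1r exprS !mulrA T01 !mul0r.
  - by rewrite expr0 mul1r exprS -mulrA starM -mulrA T10 mulr0.
  - rewrite !exprS -!mulrA starM -mulrA (mulrA (star T1)) T11 mul1r.
    exact: IH.
by rewrite key.
Qed.

End CuntzKrieger.

Section GaugeInvariance.
Context (R : realType) (B : cstarType R) (N : nat) (A : 'M[nat]_N).
Context (S : 'I_N -> B).
Hypothesis hB : is_cuntz_krieger A S.

Lemma gauge_morphism (z : R[i]) : z * z^* = 1 ->
  exists2 f : {lrmorphism B -> B}, star_preserving f &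
    forall i, f (S i) = z *: S i.
Proof.
move=> z1; have [[S1 S2] _ univ] := hB; apply: univ; split=> [|i k].
  rewrite -[RHS]S1; apply: eq_bigr => i _.
  by rewrite starZ -scalerAl -scalerAr scalerA z1 scale1r.
rewrite starZ -scalerAl -scalerAr scalerA mulrC z1 scale1r S2.
congr (_ *+ _); apply: eq_bigr => j _.
by rewrite starZ -scalerAl -scalerAr scalerA z1 scale1r.
Qed.

(* Averaging a state with its rotation by z, where z ^+ d = -1, kills the
   elements of degree d. *)
Lemma state_killing D : exists2 om : {linear B -> R[i] | *%R}, state om &
  forall d x, (0 < d <= D)%N -> homog S d x -> om x = 0.
Proof.
elim: D => [|D [om som kom]].
  by have [om som] := @state_exists R B; exists om => // -[].
pose z : R[i] := D.+1.-root (-1).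
have zD : z ^+ D.+1 = -1 by apply: rootCK.
have z1 : z * z^* = 1.
  rewrite -normCK; have : `|z| ^+ D.+1 = 1 by rewrite -normrX zD normrN normr1.
  by move/eqP; rewrite pexpr_eq1 // => /eqP ->; rewrite expr1n.
have [f sf fS] := gauge_morphism z1.
pose g x := 2%:R^-1 * (om x + om (f x)).
have gL : linear_for *%R g.
  move=> a x y; have omP x' y' : om (a *: x' + y') = a * om x' + om y'.
    by rewrite linearP.
  have fP : f (a *: x + y) = a *: f x + f y by rewrite linearP.
  rewrite /g fP !omP.
  by move: (om x) (om y) (om (f x)) (om (f y)) => *; ring.
pose gm := GRing.isLinear.Build R[i] B R[i] *%R g gL.
pose om' : {linear B -> R[i] | *%R} := HB.pack g gm.
have omE x : om' x = 2%:R^-1 * (om x + om (f x)) by [].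
exists om' => [|d x /andP[d0]].
  split=> [|x]; rewrite omE.
    by rewrite rmorph1 (proj1 som) -mulr2n mulVf // pnatr_eq0.
  rewrite mulr_ge0 ?invr_ge0 ?ler0n // addr_ge0 ?(proj2 som) //.
  by rewrite rmorphM /= sf (proj2 som).
rewrite leq_eqVlt => /orP[/eqP ->|dD] hx.
  rewrite omE (hx z) // zD linearZ /= mulN1r subrr mulr0 //.
have kx : om x = 0 by apply: kom hx; rewrite d0 -ltnS.
by rewrite omE (hx z) // linearZ /= kx mulr0 addr0 mulr0.
Qed.

End GaugeInvariance.

(** * Sums over words of given lengths *)

Section Words.
Context (N : nat).

Fixpoint words n : seq (seq 'I_N) :=
  if n is m.+1 then [seq i :: w | i <- enum 'I_N, w <- words m] else [:: [::]].

Lemma mem_words n w : (w \in words n) = (size w == n).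
Proof.
elim: n w => [|n IH] w /=; first by rewrite inE; case: w.
apply/allpairsP/eqP => [[[i v] /= [_]]|].
  by rewrite IH => /eqP <- ->.
by case: w => // i w [wn]; exists (i, w); rewrite mem_enum IH wn.
Qed.

Lemma uniq_words n : uniq (words n).
Proof.
elim: n => //= n IH; apply: allpairs_uniq => //; first exact: enum_uniq.
by move=> [i v] [j w] _ _ /= [-> ->].
Qed.

Section Sums.
Variable V : zmodType.
Implicit Type F : seq 'I_N -> V.

Lemma sum_wordsS n F :
  \sum_(w <- words n.+1) F w = \sum_i \sum_(w <- words n) F (i :: w).
Proof. by rewrite /= big_allpairs_dep big_enum. Qed.

Lemma sum_words_cat p t F : \sum_(w <- words (p + t)) F w =
  \sum_(u <- words p) \sum_(w <- words t) F (u ++ w).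
Proof.
elim: p F => [|p IH] F; first by rewrite /= big_seq1.
rewrite addSn sum_wordsS sum_wordsS; apply: eq_bigr => i _.
exact: IH.
Qed.

Lemma sum_words_eq p u F : size u = p ->
  (forall w, size w = p -> w != u -> F w = 0) -> \sum_(w <- words p) F w = F u.
Proof.
move=> up F0; rewrite (bigD1_seq u) ?uniq_words ?mem_words ?up //=.
rewrite big_seq_cond big1 ?addr0 // => w /andP[].
by rewrite mem_words => /eqP; apply: F0.
Qed.

End Sums.
End Words.

Section Window.
Context (N : nat) (A : 'M[nat]_N) (n : nat).

Definition window : seq (seq 'I_N) :=
  [seq w | p <- iota n.+1 n, w <- [seq w <- words N p | admissible A w]].

Lemma mem_window w :
  (w \in window) = [&& n < size w, size w <= n + n & admissible A w]%N.
Proof.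
apply/allpairsPdep/and3P => [[p [v [pi vi ->]]]|[h1 h2 h3]].
  move: pi vi; rewrite mem_iota mem_filter mem_words => /andP[p1 p2].
  by move=> /andP[av /eqP vp]; rewrite vp av p1 -ltnS -addSn.
exists (size w), w; split=> //.
  by rewrite mem_iota h1 addSn ltnS.
by rewrite mem_filter h3 mem_words eqxx.
Qed.

Lemma uniq_window : uniq window.
Proof.
apply: allpairs_uniq_dep; first exact: iota_uniq.
  by move=> p _; rewrite filter_uniq // uniq_words.
move=> [p v] [q w] /allpairsPdep[p' [v' [_ h1 [-> ->]]]].
move=> /allpairsPdep[q' [w' [_ h2 [-> ->]]]] /= vw; subst w'.
by move: h1 h2; rewrite !mem_filter !mem_words => /andP[_ /eqP <-] /andP[_ /eqP <-].
Qed.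

(** Adding the inadmissible words, where the summands vanish, gives full word lists, which split
    along concatenation. *)
Lemma sum_window (V : zmodType) (F : seq 'I_N -> V) :
  (forall w, ~~ admissible A w -> F w = 0) ->
  \sum_(w <- window) F w = \sum_(p <- iota n.+1 n) \sum_(w <- words N p) F w.
Proof.
move=> F0; rewrite /window big_allpairs_dep; apply: eq_bigr => p _.
rewrite big_filter [RHS](bigID (admissible A)) /= [X in _ + X]big1 ?addr0 //.
Qed.

End Window.

(** * Approximation of O_A through matrix algebras *)

(** Each [a] has at most one partner, [b = a - p + q]. The bounds on [p] and [q] keep the truncated
    subtractions exact; the exact count is n - |p - q|, but the weaker bound is enough. *)
Lemma shifted_window_count n p q : (p <= n)%N -> (q <= n)%N ->
  (n - (p + q) <= \sum_(a <- iota n.+1 n) \sum_(b <- iota n.+1 n)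
     (a - p == b - q) <= n)%N.
Proof.
move=> pn qn; pose P a := ((n < a - p + q) && (a - p + q <= n + n))%N.
have inner a : (n < a)%N ->
    (\sum_(b <- iota n.+1 n) (a - p == b - q) = P a :> nat)%N.
  move=> na; set c := (a - p + q)%N.
  have ceq b : b \in iota n.+1 n -> (a - p == b - q)%N = (b == c).
    by rewrite mem_iota /c => /andP[b1 b2]; apply/eqP/eqP; lia.
  rewrite big_seq (eq_bigr (fun b => (b == c) : nat)); last first.
    by move=> b /ceq ->.
  rewrite -big_seq; case: (boolP (c \in iota n.+1 n)) => hc.
    rewrite (bigD1_seq c) ?iota_uniq //= eqxx big1 => [|b /negPf ->] //.
    by move: hc; rewrite mem_iota addSn ltnS /P => ->.
  rewrite big_seq big1 => [|b hb]; last by case: eqP hc => // <-; rewrite hb.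
  by move: hc; rewrite mem_iota addSn ltnS /P => /negPf ->.
rewrite big_seq (eq_bigr (fun a => P a : nat)); last first.
  by move=> a; rewrite mem_iota => /andP[na _]; apply: inner.
rewrite -big_seq; apply/andP; split; last first.
  rewrite -[leqRHS](size_iota n.+1 n) -sum1_size leq_sum // => a _.
  exact: leq_b1.
have [npq|npq] := leqP n (p + q); first by rewrite (eqP (_ : n - (p + q) == 0)%N).
(* Every [a] in the middle block has its partner inside the window. *)
have -> : iota n.+1 n = iota n.+1 p ++ iota (n.+1 + p) (n - (p + q)) ++
    iota (n.+1 + p + (n - (p + q))) q.
  by rewrite -!iotaD; congr iota; lia.
rewrite !big_cat /=; apply: leq_trans (leq_trans _ (leq_addr _ _)) (leq_addl _ _).
rewrite -[leqLHS](size_iota (n.+1 + p)) -sum1_size !big_seq leq_sum // => a.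
by rewrite mem_iota /P => /andP[a1 a2]; rewrite lt0b; apply/andP; lia.
Qed.

Lemma ratio_bound (R : realType) (n c d : nat) : (0 < n)%N ->
  (n - d <= c <= n)%N -> `|c%:R / n%:R - 1| <= d%:R / n%:R :> R.
Proof.
move=> n0 /andP[c1 c2]; have np : 0 < n%:R :> R by rewrite ltr0n.
have -> : c%:R / n%:R - 1 = - ((n - c)%:R / n%:R) :> R.
  by rewrite natrB //; field; rewrite gt_eqF.
rewrite normrN ger0_norm ?divr_ge0 // ler_pM2r ?invr_gt0 // ler_nat; lia.
Qed.

Section Approximation.
Context (R : realType) (B : cstarType R) (N : nat) (A : 'M[nat]_N).
Context (S : 'I_N -> B).
Hypotheses (N2 : (2 <= N)%N) (hA01 : zero_one A) (hA : primitive_mx A).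
Hypothesis hB : is_cuntz_krieger A S.
Local Notation wordS := (wordS S).

Let hS : ck_relations A S. Proof. by case: hB. Qed.

Lemma sum_wordS_star t : \sum_(w <- words N t) wordS w * star (wordS w) = 1.
Proof.
elim: t => [|t IH]; first by rewrite big_seq1 star1 mulr1.
rewrite sum_wordsS -[RHS](sum_rproj hS); apply: eq_bigr => i _ /=.
transitivity (S i * (\sum_(w <- words N t) wordS w * star (wordS w)) * star (S i)).
  rewrite mulr_sumr mulr_suml; apply: eq_bigr => w _.
  by rewrite starM !mulrA.
by rewrite IH mulr1.
Qed.

(** The multiplier sees [u] and [v] only through their lengths, hence is a scalar on the whole span
    of a bidegree, which is all that a linear change of generators preserves. *)
Lemma word_approximation n : (0 < n)%N ->
  exists r (phi : {linear B -> 'M[R[i]]_r.+1}) (psi : {linear 'M[R[i]]_r.+1 -> B})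
    (c : nat -> nat -> R),
  [/\ ucp phi, ucp psi,
    forall p q, (p <= n)%N -> (q <= n)%N -> `|c p q - 1| <= (p + q)%:R / n%:R
  & forall u v, (size u <= n)%N -> (size v <= n)%N ->
      psi (phi (wordS u * star (wordS v))) =
        (c (size u) (size v))%:C *: (wordS u * star (wordS v))].
Proof.
move=> n0.
have [m [U [U1 U2 U3]]] := sproj_isometries hA01 hA hS.
have [om som kom] := state_killing hB (n + n).
pose i0 : 'I_N := Ordinal (ltnW N2).
pose tailU w := U (last i0 w).
pose Z w := wordS w * tailU w.
have homZ w : w != [::] -> homog S (size w + m) (Z w).
  by move=> _; apply: homogM; [exact: homog_wordS|exact: U1].
(* Stated beyond the window, because it is applied to words that have lost a prefix. *)
have omZ w v : admissible A w -> w != [::] -> v != [::] ->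
    (size w <= n + n)%N -> (size v <= n + n)%N ->
    om (star (Z w) * Z v) = (w == v)%:R.
  have starMC (x y : B) : star x * y = star (star y * x).
    by rewrite starM starK.
  (* The degree [m] of the isometries cancels, leaving [size y - size x], which lies between 1 and
     [n + n], the range killed by [om]. *)
  have lt x y : x != [::] -> y != [::] -> (size y <= n + n)%N ->
      (size x < size y)%N -> om (star (Z x) * Z y) = 0.
    move=> x0 y0 yn xy; apply: (kom (size y - size x)%N); first by lia.
    apply: (@homog_starM _ _ _ _ (size x + m)); first exact: homZ.
    by rewrite (_ : _ + _ = size y + m)%N; [exact: homZ|lia].
  move=> aw w0 v0 wn vn; case: (ltngtP (size w) (size v)) => [wv|vw|wv].
  - by rewrite lt //; case: eqP wv => // ->; rewrite ltnn.
  - rewrite starMC (state_herm som) lt // conjC0.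
    by case: eqP vw => // ->; rewrite ltnn.
  - case: w v aw w0 v0 wn vn wv => // i w [|j v] // aw _ _ _ _ [wv].
    have -> : star (Z (i :: w)) * Z (j :: v) = star (U (last i w)) *
       (star (wordS (i :: w)) * wordS (j :: v)) * U (last j v).
      by rewrite /Z /= starM !mulrA.
    rewrite (star_wordS_eqsize hA01 hS _ aw wv).
    case: eqP => [[-> ->]|_]; last by rewrite mulr0 mul0r linear0.
    by rewrite -mulrA U3 U2 (proj1 som).
pose win := window A n.
have sum_win (V : zmodType) (F : seq 'I_N -> V) :
    (forall w, ~~ admissible A w -> F w = 0) ->
    \sum_(w <- win) F w = \sum_(p <- iota n.+1 n) \sum_(w <- words N p) F w.
  exact: sum_window.
(* The factor [n^-1] of psi is split between the two words, so that psi becomes an [expansion]. *)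
pose s0 : R := (Num.sqrt n%:R)^-1.
have s00 : s0 * s0 = n%:R^-1.
  by rewrite -expr2 exprVn sqr_sqrtr // ler0n.
have sum1 : \sum_(w <- win) (n%:R^-1)%:C *: (wordS w * star (wordS w)) = 1.
  rewrite sum_win => [|w nw]; last first.
    by rewrite (wordS_nadm hS nw) mul0r scaler0.
  rewrite (eq_bigr (fun=> (n%:R^-1)%:C *: (1 : B))) => [|p _]; last first.
    by rewrite -scaler_sumr sum_wordS_star.
  rewrite big_const_seq count_predT size_iota iter_addr_0.
  rewrite -scaler_nat scalerA -(rmorph_nat (real_complex R)) -rmorphM.
  by rewrite mulfV ?scale1r // pnatr_eq0 -lt0n.
(* A matrix algebra with nonzero unit needs a nonempty window, which [sum1] forces. *)
have [r rE] : exists r, size win = r.+1.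
  case E : (size win) => [|r]; last by exists r.
  move: sum1; rewrite (size0nil E) big_nil => /esym/eqP.
  by rewrite oner_eq0.
pose wd (i : 'I_r.+1) := nth [::] win i.
have wd_win i : wd i \in win by rewrite mem_nth // rE.
have sum_wd (V : zmodType) (F : seq 'I_N -> V) :
    \sum_(i < r.+1) F (wd i) = \sum_(w <- win) F w.
  by rewrite (big_nth [::]) rE big_mkord.
have winP w : w \in win ->
    [/\ (n < size w)%N, (size w <= n + n)%N, admissible A w & w != [::]].
  by rewrite mem_window => /and3P[h1 h2 h3]; split=> //; case: w h1 {h2 h3}.
pose Zw i := Z (wd i).
have Zo i j : om (star (Zw i) * Zw j) = (i == j)%:R.
  have [_ i2 i3 i4] := winP _ (wd_win i); have [_ j2 _ j4] := winP _ (wd_win j).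
  by rewrite omZ // nth_uniq ?rE // uniq_window.
pose s i := s0%:C *: wordS (wd i).
have sE i j : s i * star (s j) =
    (n%:R^-1)%:C *: (wordS (wd i) * star (wordS (wd j))).
  by rewrite /s star_scale -scalerAl -scalerAr scalerA -rmorphM s00.
have s1 : \sum_i s i * star (s i) = 1.
  rewrite -[RHS]sum1 -sum_wd; apply: eq_bigr => i _; exact: sE.
have [V Vo] := orthogonal_isometries hA01 hA hS N2 r.+1.
exists r, (compression om Zw), (expansion s).
exists (fun p q => (\sum_(a <- iota n.+1 n) \sum_(b <- iota n.+1 n)
   (a - p == b - q))%N%:R / n%:R).
split; [exact: compression_ucp|exact: (expansion_ucp Vo)| |].
  by move=> p q pn qn; apply: ratio_bound => //; apply: shifted_window_count.
move=> u u' un un'; set x := wordS u * star (wordS u').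
have takeZ w y : w \in win -> (size y <= n)%N -> star (wordS y) * Z w =
    if take (size y) w == y then Z (drop (size y) w) else 0.
  move=> /winP[w1 w2 w3 w4] yn; have yw : (size y < size w)%N by lia.
  rewrite /Z mulrA (star_wordS_take hA01 hS w3 yw).
  case: eqP => _; last by rewrite mul0r.
  (* As the remaining tail is nonempty, it ends in the same letter as [w], so the isometry is
     unchanged. *)
  rewrite /tailU; congr (_ * U _).
  rewrite -{1}(cat_take_drop (size y) w) last_cat.
  case E : (drop (size y) w) => [|j d] //.
  by move: yw; rewrite -subn_gt0 -size_drop E.
have omx w v : w \in win -> v \in win -> om (star (Z w) * x * Z v) =
   [&& take (size u) w == u, take (size u') v == u' &
       drop (size u) w == drop (size u') v]%:R.
  have split_mid (a b c d : B) :
      star a * (b * star c) * d = star (star b * a) * (star c * d).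
    by rewrite starM starK !mulrA.
  move=> hw hv; rewrite /x split_mid.
  rewrite !takeZ //; case: eqP => _; last by rewrite star0 mul0r linear0.
  case: eqP => _; last by rewrite mulr0 linear0.
  have [w1 w2 w3 w4] := winP _ hw; have [v1 v2 v3 v4] := winP _ hv.
  have ndrop k y : (k <= n)%N -> (n < size y)%N -> drop k y != [::].
    by move=> kn ny; rewrite -size_eq0 size_drop -lt0n subn_gt0 (leq_ltn_trans kn).
  have sdrop k y : (size y <= n + n)%N -> (size (drop k y) <= n + n)%N.
    by move=> ny; rewrite size_drop (leq_trans (leq_subr _ _)).
  by rewrite omZ ?ndrop ?sdrop //; apply: drop_sorted.
pose G w v := [&& take (size u) w == u, take (size u') v == u' &
   drop (size u) w == drop (size u') v]%:R *:
  ((n%:R^-1)%:C *: (wordS w * star (wordS v))).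
transitivity (\sum_(w <- win) \sum_(v <- win) G w v).
  rewrite /= /expansion -sum_wd; apply: eq_bigr => i _.
  rewrite -sum_wd; apply: eq_bigr => j _.
  by rewrite mxE sE /Zw omx.
have G0l w v : ~~ admissible A w -> G w v = 0.
  by move=> nw; rewrite /G (wordS_nadm hS nw) mul0r !scaler0.
have G0r w v : ~~ admissible A v -> G w v = 0.
  by move=> nv; rewrite /G (wordS_nadm hS nv) star0 mulr0 !scaler0.
(* For fixed lengths the surviving pairs are [u ++ w'] and [u' ++ w']; they exist only if both tails
   have the same length. *)
have blockE a b : (n < a)%N -> (n < b)%N ->
    \sum_(w <- words N a) \sum_(v <- words N b) G w v =
    ((n%:R^-1)%:C *: x) *+ (a - size u == b - size u')%N.
  move=> na nb; have [t aE] : exists t, a = (size u + t)%N.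
    by exists (a - size u)%N; lia.
  have [t' bE] : exists t', b = (size u' + t')%N.
    by exists (b - size u')%N; lia.
  rewrite aE bE !addKn sum_words_cat (@sum_words_eq _ _ _ u) //; last first.
    move=> w wu nwu; rewrite big1 // => w' _; rewrite big1 // => v _.
    by rewrite /G take_cat wu ltnn subnn take0 cats0 (negPf nwu) scale0r.
  rewrite (eq_bigr (fun w' => \sum_(v' <- words N t') (w' == v')%:R *:
     ((n%:R^-1)%:C *: (wordS (u ++ w') * star (wordS (u' ++ v')))))); last first.
    move=> w' _; rewrite sum_words_cat (@sum_words_eq _ _ _ u') //; last first.
      move=> w wu nwu; rewrite big1 // => v' _; rewrite /G take_size_cat //.
      by rewrite eqxx take_size_cat // (negPf nwu) scale0r.
    apply: eq_bigr => v' _; rewrite /G !take_size_cat // !eqxx /=.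
    by rewrite !drop_size_cat.
  case: eqP => [<-|tt']; last first.
    rewrite mulr0n big_seq big1 // => w'; rewrite mem_words => /eqP w't.
    rewrite big_seq big1 // => v'; rewrite mem_words => /eqP v't.
    by case: eqP => [wv|_]; [case: tt'; rewrite -w't -v't wv|rewrite scale0r].
  (* Summing over the common tail inserts 1 between [wordS u] and [star (wordS u')], so the block
     contributes exactly one copy of [x]. *)
  rewrite mulr1n /x -[wordS u]mulr1 -(sum_wordS_star t) mulr_sumr mulr_suml.
  rewrite scaler_sumr !big_seq; apply: eq_bigr => w'; rewrite mem_words => /eqP w't.
  rewrite (@sum_words_eq _ _ _ w') // => [|v' _ /negPf]; last first.
    by rewrite eq_sym => ->; rewrite scale0r.
  by rewrite eqxx scale1r !wordS_cat starM !mulrA.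
rewrite sum_win => [|w nw]; last by rewrite big1 // => v _; apply: G0l.
rewrite (eq_big_seq (fun a => \sum_(b <- iota n.+1 n)
   ((n%:R^-1)%:C *: x) *+ (a - size u == b - size u')%N)) => [|a]; last first.
  rewrite mem_iota => /andP[na _].
  rewrite (eq_bigr (fun w => \sum_(b <- iota n.+1 n) \sum_(v <- words N b) G w v)).
    rewrite exchange_big; apply: eq_big_seq => b; rewrite mem_iota => /andP[nb _].
    exact: blockE.
  by move=> w _; apply: sum_win => v; apply: G0r.
under eq_bigr do rewrite sumrMnr.
rewrite sumrMnr -scaler_nat scalerA; congr (_ *: _).
by rewrite rmorphM /= rmorph_nat.
Qed.

End Approximation.

(** * Ranks, and vanishing of the entropy under a uniform bound *)

Section Rank.
Context (R : realType) (C : fdCstarType R).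

(** An abelian subalgebra of largest dimension is maximal. The value of the rank is immaterial, as
    one algebra will serve all times. *)
Lemma cstar_rank_exists : exists r, cstar_rank C r.
Proof.
pose P d := `[< exists2 V : {vspace C}, abelian_subalgebra V & \dim V = d >].
have P0 : exists d, P d.
  exists 0%N; apply/asboolP; exists 0%VS; last exact: dimv0.
  split=> [x y|x|x y]; rewrite ?memv0.
  - by move=> /eqP -> _; rewrite mul0r.
  - by move=> /eqP ->; rewrite star0.
  - by move=> /eqP -> /eqP ->.
have Pmax d : P d -> (d <= \dim {:C})%N.
  by move=> /asboolP[V _ <-]; exact: dimvS (subvf V).
case: (ex_maxnP P0 Pmax) => r /asboolP[V aV Vr] rmax; exists r, V => //.
split=> // W aW VW; apply/esym/eqP; rewrite eqEdim VW Vr; apply: rmax.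
by apply/asboolP; exists W.
Qed.

(** Abelian subalgebras may be zero, but the line through 1 strictly contains the zero one. This
    keeps the logarithms of [rcp] nonnegative. *)
Lemma cstar_rank_gt0 r : cstar_rank C r -> (0 < r)%N.
Proof.
move=> [V [aV Vmax] <-]; rewrite lt0n dimv_eq0; apply/negP => /eqP V0.
have aW : abelian_subalgebra <[1 : C]>%VS.
  split=> [x y|x|x y].
  - move=> /vlineP[k ->] /vlineP[l ->]; rewrite -scalerAl mul1r.
    by rewrite memvZ // memvZ // memv_line.
  - by move=> /vlineP[k ->]; rewrite starZ star1 memvZ // memv_line.
  - move=> /vlineP[k ->] /vlineP[l ->].
    by rewrite -!scalerAl -!scalerAr !scalerA mulrC.
have := Vmax _ aW; rewrite V0 sub0v => /(_ isT)/eqP.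
by rewrite -dimv_eq0 dim_vline oner_eq0.
Qed.

End Rank.

Section UniformRcp.
Context (R : realType) (B : cstarType R).

Lemma rcp_ge1 (Omega : set B) e : (1 <= rcp Omega e)%E.
Proof.
apply: le_ereal_inf_tmp => _ [r [C [phi [psi [_ _ _ rC]]]] <-].
by rewrite lee_fin ler1n; apply: cstar_rank_gt0 rC.
Qed.

Lemma ht_at_bounded (alpha : B -> B) Omega (e : R) (r : nat) : (0 < r)%N ->
  (forall n, (rcp (iter_union alpha Omega n) e <= r%:R%:E)%E) ->
  ht_at alpha Omega e = 0%E.
Proof.
move=> r0 rb; rewrite /ht_at.
set v := (X in limn_esup X); suff v0 : v @ \oo --> 0%E.
  by rewrite (cvg_limn_einf_sup v0).2.
have l0 n : (0 <= lne (rcp (iter_union alpha Omega n) e))%E.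
  by rewrite lne_ge0 rcp_ge1.
apply: (@squeeze_cvge _ _ _ _ (cst 0%E) v (fun n => (ln (r%:R : R) * n%:R^-1)%:E)).
- apply: nearW => n /=; rewrite /v mule_ge0 ?lee_fin ?invr_ge0 //=.
  rewrite EFinM lee_wpmul2r ?lee_fin ?invr_ge0 //.
  have mem (y : \bar R) : (1 <= y)%E -> y \in `[0%E, +oo%E].
    by move=> y1; rewrite in_itv /= leey andbT (le_trans _ y1) // lee_fin.
  rewrite -lne_EFin ?ltr0n // lee_lne ?rb // mem ?rcp_ge1 //.
  by rewrite lee_fin ler1n.
- exact: cvg_cst.
- apply/cvg_EFin; first by apply: nearW.
  rewrite -(mulr0 (ln (r%:R : R))); apply: cvgM; first exact: cvg_cst.
  by rewrite -cvg_shiftS; exact: cvg_harmonic.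
Qed.

End UniformRcp.

Section PositiveUcp.
Context (R : realType) (B D E : cstarType R).

Lemma ucp_positive (f : {linear B -> D}) : ucp f -> positive_map f.
Proof.
move=> [cp _] x; pose X : 'M[B]_1 := const_mx x.
have [|Y YE] := cp 1%N (star_mx X *m X); first by exists X.
have := congr1 (fun M : 'M[D]_1 => M 0 0) YE.
rewrite !mxE !big_ord1 !mxE => ->; exact: pos_starM.
Qed.

Lemma ucp_comp (f : {linear B -> D}) (g : {linear D -> E}) : ucp f -> ucp g ->
  ucp (g \o f).
Proof.
move=> [cf f1] [cg g1]; split=> [n X pX|]; last by rewrite /= f1 g1.
have -> : map_mx (g \o f) X = map_mx g (map_mx f X).
  by apply/matrixP => i j; rewrite !mxE.
by apply: cg; apply: cf.
Qed.

Lemma lrmorphism_positive (f : {lrmorphism B -> D}) : star_preserving f ->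
  positive_map f.
Proof. by move=> sf x; rewrite rmorphM /= sf; apply: pos_starM. Qed.

End PositiveUcp.

(** * Density of the monomials and quasi-free automorphisms *)

Section Span.
Context (R : realType).
Implicit Types B D : cstarType R.

(** Encoding the span as an intersection of subspaces gives its induction principle without
    manipulating finite combinations. *)
Definition lspan B (G : set B) : set B := [set x | forall E : set B,
  E 0 -> (forall a y z, E y -> E z -> E (a *: y + z)) -> G `<=` E -> E x].

Lemma lspan_gen B (G : set B) : G `<=` lspan G.
Proof. by move=> x Gx E _ _; apply. Qed.

Lemma lspan_ind B (G E : set B) : E 0 ->
  (forall a y z, E y -> E z -> E (a *: y + z)) -> G `<=` E -> lspan G `<=` E.
Proof. by move=> E0 EP EG x; apply. Qed.

Lemma lspan0 B (G : set B) : lspan G 0.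
Proof. by move=> E E0. Qed.

Lemma lspanP B (G : set B) a x y : lspan G x -> lspan G y ->
  lspan G (a *: x + y).
Proof. by move=> hx hy E E0 EP EG; exact: EP (hx E E0 EP EG) (hy E E0 EP EG). Qed.

Lemma lspanZ B (G : set B) a x : lspan G x -> lspan G (a *: x).
Proof.
by move=> hx; rewrite -[_ *: _]addr0; apply: lspanP => //; apply: lspan0.
Qed.

Lemma lspanD B (G : set B) x y : lspan G x -> lspan G y -> lspan G (x + y).
Proof. by move=> hx hy; rewrite -[x]scale1r; apply: lspanP. Qed.

Lemma lspan_sum B (G : set B) I (r : seq I) (F : I -> B) :
  (forall i, lspan G (F i)) -> lspan G (\sum_(i <- r) F i).
Proof.
by move=> h; elim/big_ind: _ => // *; exact: lspanD.
Qed.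

Lemma lspan_linear B D (f : {linear B -> D}) (G : set B) (H : set D) :
  (forall x, G x -> lspan H (f x)) -> forall x, lspan G x -> lspan H (f x).
Proof.
move=> GH; apply: (@lspan_ind _ _ [set x | lspan H (f x)]) => //= [|a y z hy hz].
  by rewrite linear0; exact: lspan0.
by rewrite linearP; apply: lspanP.
Qed.

Lemma lspan_star B (G H : set B) : (forall x, G x -> lspan H (star x)) ->
  forall x, lspan G x -> lspan H (star x).
Proof.
move=> GH; apply: (@lspan_ind _ _ [set x | lspan H (star x)]) => //= [|a y z hy hz].
  by rewrite star0; exact: lspan0.
by rewrite starD starZ; apply: lspanP.
Qed.

Lemma lspanM B (G H F : set B) :
  (forall x y, G x -> H y -> lspan F (x * y)) ->
  forall x y, lspan G x -> lspan H y -> lspan F (x * y).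
Proof.
move=> GH x y hx hy; move: x hx.
apply: (@lspan_ind _ _ [set x | lspan F (x * y)]) => /= [|a x1 x2 h1 h2|x Gx] /=.
- by rewrite mul0r; exact: lspan0.
- by rewrite mulrDl -scalerAl; apply: lspanP.
move: y hy.
apply: (@lspan_ind _ _ [set y | lspan F (x * y)]) => /= [|a y1 y2 h1 h2|y1 Hy] /=.
- by rewrite mulr0; exact: lspan0.
- by rewrite mulrDr -scalerAr; apply: lspanP.
exact: GH.
Qed.

End Span.

Section Monomials.
Context (R : realType) (B : cstarType R) (N : nat) (A : 'M[nat]_N).
Context (S : 'I_N -> B).
Hypothesis hS : ck_relations A S.
Local Notation wordS := (wordS S).

Definition monomial p q : set B := [set x | exists u v,
  [/\ size u = p, size v = q & x = wordS u * star (wordS v)]].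

Definition monomials : set B := [set x | exists p q, monomial p q x].

Lemma monomials_word u v : lspan monomials (wordS u * star (wordS v)).
Proof. by apply: lspan_gen; exists (size u), (size v), u, v. Qed.

Lemma monomials_mulS i x : lspan monomials x -> lspan monomials (S i * x).
Proof.
move: x; apply: (@lspan_ind _ _ _ [set x | lspan monomials (S i * x)])
  => /= [|a y z hy hz|_ [p [q [u [v [_ _ ->]]]]]] /=.
- by rewrite mulr0; exact: lspan0.
- by rewrite mulrDr -scalerAr; apply: lspanP.
by rewrite mulrA; exact: (monomials_word (i :: u)).
Qed.

(** If the first letter of [u] matches, the product creates a sum of [S k * star (S k)], and each
    [star (S k)] then meets a shorter word. *)
Lemma monomials_mul_starS_word i u v :
  lspan monomials (star (S i) * (wordS u * star (wordS v))).
Proof.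
elim: u i => [|j u IH] i.
  rewrite mul1r -starM; have -> : wordS v * S i = wordS (v ++ [:: i]).
    by rewrite wordS_cat /= mulr1.
  by rewrite -[star _]mul1r; exact: (monomials_word [::]).
rewrite [wordS (j :: u)]/= -/wordS -mulrA mulrA (starSS hS).
case: eqP => _; last by rewrite mul0r; exact: lspan0.
rewrite mulr_suml; apply: lspan_sum => k.
rewrite mulrnAl -scaler_nat; apply: lspanZ; rewrite -mulrA.
by apply: monomials_mulS; exact: IH.
Qed.

Lemma monomials_mul_starS i x : lspan monomials x ->
  lspan monomials (star (S i) * x).
Proof.
move: x; apply: (@lspan_ind _ _ _ [set x | lspan monomials (star (S i) * x)])
  => /= [|a y z hy hz|_ [p [q [u [v [_ _ ->]]]]]] /=.
- by rewrite mulr0; exact: lspan0.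
- by rewrite mulrDr -scalerAr; apply: lspanP.
exact: monomials_mul_starS_word.
Qed.

Lemma monomials_mul x y : lspan monomials x -> lspan monomials y ->
  lspan monomials (x * y).
Proof.
move=> hx hy; move: x hx.
apply: (@lspan_ind _ _ _ [set x | lspan monomials (x * y)])
  => /= [|a x1 x2 h1 h2|_ [p [q [u [v [_ _ ->]]]]]] /=.
- by rewrite mul0r; exact: lspan0.
- by rewrite mulrDl -scalerAl; apply: lspanP.
rewrite -mulrA; have : lspan monomials (star (wordS v) * y).
  elim: v y hy => [|i v IH] y hy /=; first by rewrite star1 mul1r.
  by rewrite starM -mulrA; apply: IH; apply: monomials_mul_starS.
move: (star _ * y) => {hy}y hy; elim: u => [|i u IH] /=; first by rewrite mul1r.
by rewrite -mulrA; apply: monomials_mulS.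
Qed.

Lemma monomials_star x : lspan monomials x -> lspan monomials (star x).
Proof.
apply: lspan_star => _ [p [q [u [v [_ _ ->]]]]].
by rewrite starM starK; exact: monomials_word.
Qed.

(** The elements approximable from the span form a C*-subalgebra containing the generators, hence
    everything. *)
Lemma monomials_dense : cstar_generated S ->
  forall x (e : R), 0 < e -> exists2 y, lspan monomials y & cnorm (x - y) < e.
Proof.
move=> gen x; pose E : set B := [set x | forall e : R, 0 < e ->
  exists2 y, lspan monomials y & cnorm (x - y) < e].
suff EE : E = setT by have : E x by rewrite EE.
apply: gen => [|i e e0]; last first.
  exists (S i); last by rewrite subrr cnorm0.
  by rewrite -[S i]mulr1 -[X in _ * X]star1 -[S i]mulr1;
    exact: (monomials_word [:: i] [::]).
split.
- move=> v l vE /cnorm_cvgP vl e e0; have e20 : 0 < e / 2 by rewrite divr_gt0.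
  have [n0 /(_ n0 (leqnn _)) h] := vl _ e20.
  have [y hy yv] := vE n0 _ e20; exists y => //.
  by have := cnorm_triangle l (v n0) y; rewrite (cnorm_distC l (v n0)); lra.
- move=> a y z yE zE e e0; have e20 : 0 < e / 2 by rewrite divr_gt0.
  have na : 0 < normc a + 1.
    by rewrite ltr_wpDl // normc_ge0.
  have [y' hy' yy'] := yE (e / 2 / (normc a + 1)) (divr_gt0 e20 na).
  have [z' hz' zz'] := zE (e / 2) e20.
  exists (a *: y' + z'); first exact: lspanP.
  have -> : a *: y + z - (a *: y' + z') = a *: (y - y') + (z - z').
    by rewrite scalerBr; zmod.
  apply: le_lt_trans (ler_cnormD _ _) _; rewrite cnormZ.
  move: yy'; rewrite ltr_pdivlMr //; have := cnorm_ge0 (y - y').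
  by have := normc_ge0 a; nra.
- move=> y z yE zE e e0; have e20 : 0 < e / 2 by rewrite divr_gt0.
  pose cz := cnorm z; have cz0 : 0 <= cz := cnorm_ge0 z.
  have [y' hy' yy'] := yE (e / 2 / (cz + 1)) (divr_gt0 e20 (ltr_wpDl cz0 ltr01)).
  pose cy := cnorm y'; have cy0 : 0 <= cy := cnorm_ge0 y'.
  (* The second tolerance depends on the approximant [y'] already chosen; adding 1 avoids a zero
     divisor. *)
  have [z' hz' zz'] := zE (e / 2 / (cy + 1)) (divr_gt0 e20 (ltr_wpDl cy0 ltr01)).
  exists (y' * z'); first exact: monomials_mul.
  have -> : y * z - y' * z' = (y - y') * z + y' * (z - z') by ncring.
  apply: le_lt_trans (ler_cnormD _ _) _.
  have := ler_cnormM (y - y') z; have := ler_cnormM y' (z - z').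
  rewrite -/cy -/cz; move: yy' zz'; rewrite !ltr_pdivlMr ?ltr_wpDl //.
  have := cnorm_ge0 (y - y'); have := cnorm_ge0 (z - z').
  move: (cnorm (y - y')) (cnorm (z - z')) => s t t0 s0 h1 h2 h3 h4.
  nra.
- move=> y yE e /yE[y' hy' yy']; exists (star y'); first exact: monomials_star.
  by rewrite -starB cnorm_starE.
- move=> e e0; exists 1; last by rewrite subrr cnorm0.
  by rewrite -[1]mulr1 -[X in _ * X]star1; exact: (monomials_word [::] [::]).
Qed.

End Monomials.

Section QuasiFree.
Context (R : realType) (B : cstarType R) (N : nat) (A : 'M[nat]_N).
Context (S : 'I_N -> B).
Hypotheses (N2 : (2 <= N)%N) (hA01 : zero_one A) (hA : primitive_mx A).
Hypothesis hB : is_cuntz_krieger A S.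
Context (f : {lrmorphism B -> B}) (u : 'M[R[i]]_N).
Hypotheses (sf : star_preserving f) (fS : forall a, f (S a) = \sum_b u b a *: S b).
Local Notation wordS := (wordS S).

Let hS : ck_relations A S. Proof. by case: hB. Qed.

Definition word_set n : set B := [set x | exists2 v, size v = n & x = wordS v].

Lemma quasifree_wordS w : lspan (word_set (size w)) (f (wordS w)).
Proof.
elim: w => [|i w IH]; first by rewrite rmorph1; apply: lspan_gen; exists [::].
rewrite [wordS _]/= -/wordS rmorphM /= fS mulr_suml; apply: lspan_sum => j.
rewrite -scalerAl; apply: lspanZ; move: (f _) IH.
apply: (@lspan_ind _ _ _ [set y | lspan (word_set (size w).+1) (S j * y)])
  => /= [|a y z hy hz|_ [v vw ->]] /=.
- by rewrite mulr0; exact: lspan0.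
- by rewrite mulrDr -scalerAr; apply: lspanP.
by apply: lspan_gen; exists (j :: v); rewrite //= vw.
Qed.

Lemma quasifree_monomial p q x :
  lspan (monomial S p q) x -> lspan (monomial S p q) (f x).
Proof.
apply: lspan_linear => _ [w [v [<- <- ->]]].
rewrite rmorphM /= sf.
apply: (@lspanM _ _ (word_set (size w)) [set star y | y in word_set (size v)]).
- move=> _ _ [w' w'w ->] [_ [v' v'v ->] <-]; apply: lspan_gen.
  by exists w', v'; rewrite v'v.
- exact: (@quasifree_wordS w).
apply: (@lspan_star _ _ (word_set (size v))) (@quasifree_wordS v) => y Wy.
by apply: lspan_gen; exists y.
Qed.

Lemma quasifree_iter_monomial p q k x :
  lspan (monomial S p q) x -> lspan (monomial S p q) (iter k f x).
Proof. by move=> hx; elim: k => //= k; exact: quasifree_monomial. Qed.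

(** As [iter k f] is itself a star morphism, the norm bound 2 holds for it; iterating the bound for
    [f] would give [2 ^ k]. *)
Lemma iter_morphism k :
  exists2 g : {lrmorphism B -> B}, star_preserving g & g =1 iter k f.
Proof.
elim: k => [|k [g sg gk]]; first by exists idfun.
exists (f \o g) => [x|x] /=; first by rewrite sg sf.
by rewrite gk.
Qed.

(** The error depends on [n] and the bidegree only, so the threshold found below is common to all
    such [theta]. *)
Definition approximates (n : nat) (theta : {linear B -> B}) :=
  [/\ positive_map theta, theta 1 = 1 & exists c : nat -> nat -> R,
    forall p q, (p <= n)%N -> (q <= n)%N ->
      `|c p q - 1| <= (p + q)%:R / n%:R /\
      forall x, monomial S p q x -> theta x = (c p q)%:C *: x].

Lemma approximates_exists n : (0 < n)%N ->
  exists r (phi : {linear B -> 'M[R[i]]_r.+1}) (psi : {linear 'M[R[i]]_r.+1 -> B}),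
  [/\ ucp phi, ucp psi & approximates n (psi \o phi)].
Proof.
move=> n0; have [r [phi [psi [c [uphi upsi cb cE]]]]] :=
  word_approximation N2 hA01 hA hB n0.
exists r, phi, psi; split=> //; have uc := ucp_comp uphi upsi.
split; [exact: ucp_positive|exact: (proj2 uc)|exists c => p q pn qn].
by split=> [|_ [w [v [wp vq ->]]]]; [exact: cb|rewrite /= cE ?wp ?vq].
Qed.

(* Since f preserves the span of the monomials of each bidegree, one
   approximation serves the whole orbit. *)
Lemma uniform_approximation b (e : R) : 0 < e -> exists n0, forall n theta k,
  (n0 <= n)%N -> approximates n theta ->
  cnorm (theta (iter k f b) - iter k f b) < e.
Proof.
have fb k x : cnorm (iter k f x) <= 2 * cnorm x.
  have [g sg <-] := iter_morphism k.
  by apply: cnorm_positive_map; [exact: lrmorphism_positive|rewrite rmorph1].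
have fP k a x y : iter k f (a *: x + y) = a *: iter k f x + iter k f y.
  by have [g sg gk] := iter_morphism k; rewrite -!gk linearP.
pose good : set B := [set x | forall e : R, 0 < e -> exists n0, forall n theta k,
  (n0 <= n)%N -> approximates n theta ->
  cnorm (theta (iter k f x) - iter k f x) < e].
have good_mono x : lspan (monomials S) x -> good x.
  move: x; apply: (@lspan_ind _ _ _ good)
    => [d d0|a y z hy hz d d0|x [p [q hx]] d d0].
  - exists 0%N => n theta k _ _.
    have f0 : iter k f 0 = 0 by elim: k => //= k ->; rewrite linear0.
    by rewrite f0 linear0 subrr cnorm0.
  - have d20 : 0 < d / 2 by rewrite divr_gt0.
    have na : 0 < normc a + 1 by rewrite ltr_wpDl // normc_ge0.
    have [n1 h1] := hy (d / 2 / (normc a + 1)) (divr_gt0 d20 na).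
    have [n2 h2] := hz (d / 2) d20.
    exists (maxn n1 n2) => n theta k; rewrite geq_max => /andP[n1n n2n] ap.
    have {}h1 := h1 n theta k n1n ap; have {}h2 := h2 n theta k n2n ap.
    rewrite fP linearP.
    move: h1 h2; set s := iter k f y; set t := iter k f z => h1 h2.
    have -> : a *: theta s + theta t - (a *: s + t) =
        a *: (theta s - s) + (theta t - t) by rewrite scalerBr; zmod.
    apply: le_lt_trans (ler_cnormD _ _) _; rewrite cnormZ.
    move: h1; rewrite ltr_pdivlMr //; have := cnorm_ge0 (theta s - s).
    by have := normc_ge0 a; nra.
  - pose K := (p + q)%:R * (2 * cnorm x).
    have K0 : 0 <= K by rewrite !mulr_ge0 // cnorm_ge0.
    have [m hm] : exists m : nat, K / d < m%:R.
      by exists (Num.bound (K / d)); exact: archi_boundP (divr_ge0 K0 (ltW d0)).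
    (* Being above [p + q] makes the multiplier bound available, and being above [m] makes [K / n],
       which bounds the error along the whole orbit, smaller than [d]. *)
    exists (maxn (p + q) m).+1 => n theta k hn [_ _ [c hc]].
    have [pn qn mn n0] : [/\ (p <= n)%N, (q <= n)%N, (m <= n)%N & (0 < n)%N].
      by move: hn; rewrite gtn_max => /andP[? ?]; split; lia.
    have [cb cE] := hc p q pn qn.
    have thE y : lspan (monomial S p q) y -> theta y = (c p q)%:C *: y.
      move: y; apply: (@lspan_ind _ _ _ [set y | theta y = (c p q)%:C *: y])
        => /= [|a y1 y2 h1 h2|y' hy']; [by rewrite linear0 scaler0| |exact: cE].
      by rewrite linearP h1 h2 scalerDr !scalerA mulrC.
    rewrite thE; last by apply: quasifree_iter_monomial; apply: lspan_gen.
    have -> : forall y : B, (c p q)%:C *: y - y = (c p q - 1)%:C *: y.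
      by move=> y; rewrite rmorphB rmorph1 scalerBl scale1r.
    rewrite cnorm_scale; apply: le_lt_trans (_ : K / n%:R < d).
      rewrite /K mulrAC; apply: ler_pM => //; exact: cnorm_ge0.
    rewrite ltr_pdivrMr ?ltr0n // mulrC -ltr_pdivrMr //.
    by apply: lt_le_trans hm _; rewrite ler_nat.
(* The iterate of [b - y] has norm at most [2 * (e / 12)] and its image under [theta] at most
   [4 * (e / 12)]. Together this is [e / 2], and the other half is spent on [y]. *)
move=> e0; have d0 : 0 < e / 12 by rewrite divr_gt0.
have gen : cstar_generated S by case: hB.
have [y hy yb] := monomials_dense hS gen b d0.
have e20 : 0 < e / 2 by rewrite divr_gt0.
have [n0 hn0] := good_mono y hy _ e20; exists n0 => n theta k n0n ap.
have {}hn0 := hn0 n theta k n0n ap; have [pth th1 _] := ap.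
have fB x z : iter k f (x - z) = iter k f x - iter k f z.
  by have [g sg gk] := iter_morphism k; rewrite -!gk raddfB.
have h1 := fb k (b - y); have h2 := cnorm_positive_map pth th1 (iter k f (b - y)).
have -> : theta (iter k f b) - iter k f b = theta (iter k f (b - y)) +
    ((theta (iter k f y) - iter k f y) - iter k f (b - y)).
  have thB x z : theta (x - z) = theta x - theta z by rewrite linearB.
  by rewrite fB thB; zmod.
apply: le_lt_trans (ler_cnormD _ _) _.
move: hn0 h1 h2; set w := iter k f (b - y); set v := theta _ - _ => hv h1 h2.
have := ler_cnormD v (- w); rewrite cnormN; lra.
Qed.

(** One factorization, chosen from [Omega] and [e] alone, is valid for every iterate, so the rank of
    a single matrix algebra bounds all the [rcp]. *)
Lemma quasifree_ht_at (Omega : set B) (e : R) : finite_set Omega -> 0 < e ->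
  ht_at f Omega e = 0%E.
Proof.
move=> /finite_seqP[s ->] e0.
have [n0 hn0] : exists n0, forall b, b \in s -> forall n theta k, (n0 <= n)%N ->
    approximates n theta -> cnorm (theta (iter k f b) - iter k f b) < e.
  elim: s => [|b s [n1 h1]]; first by exists 0%N.
  have [n2 h2] := uniform_approximation b e0.
  exists (maxn n1 n2) => x xs n theta k; rewrite geq_max => /andP[n1n n2n].
  by move: xs; rewrite inE => /predU1P[->|xs]; [exact: h2|exact: h1].
have [r [phi [psi [uphi upsi ap]]]] := approximates_exists (ltn0Sn n0).
have [d hd] := @cstar_rank_exists R 'M[R[i]]_r.+1.
apply: (@ht_at_bounded _ _ _ _ _ d); first exact: cstar_rank_gt0 hd.
move=> n; apply: ereal_inf_lbound; exists d => //.
exists 'M[R[i]]_r.+1, phi, psi; split=> // _ [k _ [b /= bs <-]].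
exact: (hn0 b bs _ _ k (leqnSn n0) ap).
Qed.

Lemma quasifree_ht : ht f = 0%E.
Proof.
rewrite /ht -[RHS]ereal_sup1; congr ereal_sup; apply/seteqP; split=> h /=.
  by move=> [G [e [fG e0 ->]]]; rewrite quasifree_ht_at.
(* The family must be shown nonempty, since the supremum of the empty set is [-oo]. *)
move=> h0; exists set0, 1; split=> //; rewrite h0.
by rewrite quasifree_ht_at.
Qed.

End QuasiFree.

Theorem theorem6p5 (R : realType) (N : nat) (hN : (2 <= N)%N)
  (A : 'M[nat]_N) (hA01 : zero_one A) (hA : primitive_mx A)
  (OA : cstarType R) (S : 'I_N -> OA) (hOA : is_cuntz_krieger A S)
  (u : 'M[R[i]%C]_N) (hu : G_A S u)
  (varphi_u : {lrmorphism OA -> OA}) (hvarphi : is_varphi S u varphi_u) :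
  ht varphi_u = 0%E.
Proof.
by have [[sf _] fS] := hvarphi; apply: (quasifree_ht hN hA01 hA hOA sf fS).
Qed.
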